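(* Let $H_1,H_2$ be Hopf algebras over $k$ (not necessarily finite dimensional). Let $\mathcal{LR}(H_1,H_2)$ be the disjoint union of all the categories ${}_{H_1}\mathcal{LR}_{H_2}(\alpha,\beta,\gamma,\delta)$ with $(\alpha,\beta,\gamma,\delta)\in G$, equipped with the tensor product, unit object, conjugation $\varphi$ and family $c=\{c_{M,N}\}$ described in the context. Then $\mathcal{LR}(H_1,H_2)$ is a braided $T$-category over $G$.
   Context: $k$ is a fixed field; all vector spaces and tensor products are over $k$, and vector spaces are treated as a strict monoidal category. Comultiplications are written $h\mapsto h_1\otimes h_2$ (Sweedler notation). $\mathrm{Aut}_{Hopf}(H)$ is the group of Hopf algebra automorphisms of $H$; juxtaposition of automorphisms denotes composition of maps. Braided $T$-category over a group $G$ with unit $1$. A crossed $T$-category $\mathcal{C}$ over $G$ consists of: a strict monoidal category $\mathcal{C}$; a family of subcategories $\{\mathcal{C}_a\}_{a\in G}$ such that $\mathcal{C}$ is the disjoint union of this family and $U\otimes V\in\mathcal{C}_{ab}$ for all $a,b\in G$, $U\in\mathcal{C}_a$, $V\in\mathcal{C}_b$; and a group homomorphism $\varphi:G\to \mathrm{Aut}(\mathcal{C})$, $b\mapsto\varphi_b$ (the conjugation), into the group of invertible strict tensor functors from $\mathcal{C}$ to itself, such that $\varphi_b(\mathcal{C}_a)=\mathcal{C}_{bab^{-1}}$ for all $a,b\in G$. For $b\in G$ write ${}^b(\cdot)=\varphi_b$, and for $V\in\mathcal{C}_b$ write ${}^V(\cdot)=\varphi_b$. A braided $T$-category is a crossed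 $T$-category endowed with a braiding, i.e. a family of isomorphisms $c=\{c_{U,V}:U\otimes V\to {}^UV\otimes U\}_{U,V\in\mathcal{C}}$ such that: (i) for $f\in \mathrm{Hom}_{\mathcal{C}_a}(U,U')$ and $g\in \mathrm{Hom}_{\mathcal{C}_b}(V,V')$, $({}^{a}g\otimes f)\circ c_{U,V}=c_{U',V'}\circ(f\otimes g)$; (ii) for all $U,V,W\in\mathcal{C}$, $c_{U\otimes V,W}=(c_{U,{}^VW}\otimes id_V)(id_U\otimes c_{V,W})$ and $c_{U,V\otimes W}=(id_{{}^UV}\otimes c_{U,W})(c_{U,V}\otimes id_W)$; (iii) for all $U,V\in\mathcal{C}$ and $a\in G$, $\varphi_a(c_{U,V})=c_{{}^aU,{}^aV}$. Category ${}_{H_1}\mathcal{LR}_{H_2}(\alpha,\beta,\gamma,\delta)$ (for $\alpha,\beta\in \mathrm{Aut}_{Hopf}(H_1)$, $\gamma,\delta\in \mathrm{Aut}_{Hopf}(H_2)$): an object is a vector space $M$ which is an $H_1$-$H_2$-bimodule (left $H_1$-action $h'\otimes m\mapsto h'\triangleright m$ and right $H_2$-action $m\otimes h''\mapsto m\triangleleft h''$, commuting) and an $H_1$-$H_2$-bicomodule (left $H_1$-coaction $m\mapsto m_{(-1)}\otimes m_{(0)}\in H_1\otimes M$ and right $H_2$-coaction $m\mapsto m_{[0]}\otimes m_{[1]}\in M\otimes H_2$, commuting), such that for all $h'\in H_1$, $h''\in H_2$, $m\in M$: \begin{align*} &\alpha(h'_1)m_{(-1)}\otimes h'_2\triangleright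 m_{(0)}=(h'_1\triangleright m)_{(-1)}\beta(h'_2)\otimes (h'_1\triangleright m)_{(0)},\\ &(h'\triangleright m)_{[0]}\otimes(h'\triangleright m)_{[1]}=h'\triangleright m_{[0]}\otimes m_{[1]},\\ &m_{[0]}\triangleleft h''_1\otimes m_{[1]}\delta(h''_2)=(m\triangleleft h''_2)_{[0]}\otimes \gamma(h''_1)(m\triangleleft h''_2)_{[1]},\\ &(m\triangleleft h'')_{(-1)}\otimes(m\triangleleft h'')_{(0)}=m_{(-1)}\otimes m_{(0)}\triangleleft h''. \end{align*} Morphisms are the $H_1$-$H_2$-bilinear and $H_1$-$H_2$-bicolinear maps. The group $G$: as a set $G=\mathrm{Aut}_{Hopf}(H_1)^2\times \mathrm{Aut}_{Hopf}(H_2)^2$, with multiplication $$(\alpha_1,\beta_1,\gamma_1,\delta_1)*(\alpha_2,\beta_2,\gamma_2,\delta_2)=(\alpha_2\alpha_1,\ \alpha_2\beta_1\alpha_2^{-1}\beta_2,\ \gamma_1\gamma_2,\ \delta_2\gamma_2^{-1}\delta_1\gamma_2),$$ unit $(id,id,id,id)$ and inverse $(\alpha,\beta,\gamma,\delta)^{-1}=(\alpha^{-1},\alpha^{-1}\beta^{-1}\alpha,\gamma^{-1},\gamma\delta^{-1}\gamma^{-1})$. Structure of $\mathcal{LR}(H_1,H_2)$: its component at $(\alpha,\beta,\gamma,\delta)\in G$ is ${}_{H_1}\mathcal{LR}_{H_2}(\alpha,\beta,\gamma,\delta)$ (an object comes with its index in $G$; there are no morphisms between different components). Tensor product: for $M\in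 {}_{H_1}\mathcal{LR}_{H_2}(\alpha_1,\beta_1,\gamma_1,\delta_1)$ and $N\in {}_{H_1}\mathcal{LR}_{H_2}(\alpha_2,\beta_2,\gamma_2,\delta_2)$, $M\otimes N$ is the object of ${}_{H_1}\mathcal{LR}_{H_2}((\alpha_1,\beta_1,\gamma_1,\delta_1)*(\alpha_2,\beta_2,\gamma_2,\delta_2))$ with structures \begin{align*} &h'\triangleright(m\otimes n)=h'_1\triangleright m\otimes h'_2\triangleright n,\\ &(m\otimes n)_{(-1)}\otimes(m\otimes n)_{(0)}=\alpha_2(m_{(-1)})\,\alpha_2\beta_1\alpha_2^{-1}(n_{(-1)})\otimes m_{(0)}\otimes n_{(0)},\\ &(m\otimes n)\triangleleft h''=m\triangleleft \gamma_2(h''_1)\otimes n\triangleleft\gamma_2^{-1}\delta_1\gamma_2(h''_2),\\ &(m\otimes n)_{[0]}\otimes(m\otimes n)_{[1]}=m_{[0]}\otimes n_{[0]}\otimes m_{[1]}n_{[1]}; \end{align*} the tensor product of morphisms is the tensor product of linear maps. The unit is $k$ with trivial structures, an object of ${}_{H_1}\mathcal{LR}_{H_2}(id,id,id,id)$. Conjugation: for $(\alpha_1,\beta_1,\gamma_1,\delta_1)\in G$ and $N\in {}_{H_1}\mathcal{LR}_{H_2}(\alpha_2,\beta_2,\gamma_2,\delta_2)$, $\varphi_{(\alpha_1,\beta_1,\gamma_1,\delta_1)}(N)={}^{(\alpha_1,\beta_1,\gamma_1,\delta_1)}N$, which is $N$ as a vector space, regarded as an object of ${}_{H_1}\mathcal{LR}_{H_2}((\alpha_1,\beta_1,\gamma_1,\delta_1)*(\alpha_2,\beta_2,\gamma_2,\delta_2)*(\alpha_1,\beta_1,\gamma_1,\delta_1)^{-1})$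 with left action $h'\rightharpoonup n=\beta_1^{-1}\alpha_1(h')\triangleright n$, left coaction $n\mapsto\alpha_1^{-1}\alpha_2\beta_1\alpha_2^{-1}(n_{(-1)})\otimes n_{(0)}$, right action $n\leftharpoonup h''=n\triangleleft \gamma_2^{-1}\delta_1\gamma_2\gamma_1^{-1}(h'')$, and right coaction $n\mapsto n_{[0]}\otimes \gamma_1\delta_1^{-1}(n_{[1]})$; $\varphi$ acts as the identity on morphisms. Braiding: for $M\in {}_{H_1}\mathcal{LR}_{H_2}(\alpha_1,\beta_1,\gamma_1,\delta_1)$ and any object $N$, with ${}^MN={}^{(\alpha_1,\beta_1,\gamma_1,\delta_1)}N$, $$c_{M,N}:M\otimes N\to {}^MN\otimes M,\qquad c_{M,N}(m\otimes n)=\beta_1^{-1}(m_{(-1)})\triangleright n_{[0]}\otimes m_{(0)}\triangleleft \delta_1^{-1}(n_{[1]}).$$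
   Formalization: The antipodes of H_1 and H_2 are assumed bijective: if either is not, some c_{M,N} is not an isomorphism and the claim fails. The suppressed associativity and unit isomorphisms of vector spaces are written explicitly instead of being treated as identities. *)

(* Defs.v *)
From HB Require Import structures.
From mathcomp Require Import all_boot all_order all_algebra.
From mathcomp Require Import boolp.

Set Implicit Arguments.
Unset Strict Implicit.
Unset Printing Implicit Defensive.

Import GRing.Theory.
Local Open Scope ring_scope.
Local Open Scope quotient_scope.

Declare Scope tensor_scope.
Delimit Scope tensor_scope with tensor.

Section TensorRelation.
Variables (k : fieldType) (U V : lmodType k).

(* A list [:: (u1, v1); ..; (un, vn)] stands for the formal sum of the
   u_i ⊗ v_i; [teq] is the congruence generated by bilinearity. *)
Inductive teq : seq (U * V) -> seq (U * V) -> Prop :=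
| teq_refl s : teq s s
| teq_sym s t : teq s t -> teq t s
| teq_trans s t r : teq s t -> teq t r -> teq s r
| teq_cat s s' t t' : teq s s' -> teq t t' -> teq (s ++ t) (s' ++ t')
| teq_catC s t : teq (s ++ t) (t ++ s)
| teq_0 v : teq [:: (0, v)] [::]
| teq_Dl u u' v : teq [:: (u + u', v)] [:: (u, v); (u', v)]
| teq_Dr u v v' : teq [:: (u, v + v')] [:: (u, v); (u, v')]
| teq_Z a u v : teq [:: (a *: u, v)] [:: (u, a *: v)].

Definition teqb (s t : seq (U * V)) : bool := `[< teq s t >].

Lemma teqb_refl : reflexive teqb.
Proof. by move=> s; apply/asboolP; apply: teq_refl. Qed.
Lemma teqb_sym : symmetric teqb.
Proof. by move=> s t; apply/asboolP/asboolP; apply: teq_sym. Qed.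
Lemma teqb_trans : transitive teqb.
Proof.
by move=> s t r /asboolP ts /asboolP sr; apply/asboolP; apply: teq_trans ts sr.
Qed.

Canonical teqb_equiv : equiv_rel (seq (U * V)) :=
  EquivRel teqb teqb_refl teqb_sym teqb_trans.

Definition tensor := {eq_quot teqb}%qT.
HB.instance Definition _ := Choice.on tensor.
HB.instance Definition _ := EqQuotient.on tensor.

Lemma pi_teq s t : teq s t <-> \pi_tensor s = \pi_tensor t.
Proof.
split=> [st | /eqmodP/asboolP //].
by apply/eqmodP/asboolP.
Qed.

Lemma repr_teq s : teq (repr (\pi_tensor s)) s.
Proof. by apply/pi_teq; rewrite reprK. Qed.

End TensorRelation.

Section TensorSpace.
Variables (k : fieldType) (U V : lmodType k).
Implicit Types (s t : seq (U * V)) (x y z : tensor U V).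
Local Notation T := (tensor U V).

Definition fscale (a : k) s := [seq (a *: p.1, p.2) | p <- s].

Lemma fscale_teq a s t : teq s t -> teq (fscale a s) (fscale a t).
Proof.
elim=> {s t}.
- by move=> *; apply: teq_refl.
- by move=> s t _; apply: teq_sym.
- by move=> s t r _ h1 _ h2; apply: teq_trans h1 h2.
- by move=> s s' t t' _ h1 _ h2; rewrite /fscale !map_cat; apply: teq_cat.
- by move=> s t; rewrite /fscale !map_cat; apply: teq_catC.
- by move=> v /=; rewrite scaler0; apply: teq_0.
- by move=> u u' v /=; rewrite scalerDr; apply: teq_Dl.
- by move=> u v v' /=; apply: teq_Dr.
- move=> b u v /=; apply: (teq_trans (t := [:: (b *: (a *: u), v)])).
    by rewrite !scalerA mulrC; apply: teq_refl.
  exact: teq_Z.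
Qed.

Definition tzero : T := \pi_T [::].
Definition tadd x y : T := \pi_T (repr x ++ repr y).
Definition tscale a x : T := \pi_T (fscale a (repr x)).

Lemma tadd_pi s t : tadd (\pi_T s) (\pi_T t) = \pi_T (s ++ t).
Proof. by apply/pi_teq/teq_cat; apply: repr_teq. Qed.

Lemma tscale_pi a s : tscale a (\pi_T s) = \pi_T (fscale a s).
Proof. by apply/pi_teq/fscale_teq/repr_teq. Qed.

Lemma taddA : associative tadd.
Proof.
elim/quotW=> s; elim/quotW=> t; elim/quotW=> r.
by rewrite (tadd_pi t r) (tadd_pi s t) (tadd_pi s) (tadd_pi (s ++ t)) catA.
Qed.

Lemma taddC : commutative tadd.
Proof.
elim/quotW=> s; elim/quotW=> t; rewrite (tadd_pi s t) (tadd_pi t s).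
by apply/pi_teq; apply: teq_catC.
Qed.

Lemma tadd0 : left_id tzero tadd.
Proof. by elim/quotW=> s; rewrite tadd_pi. Qed.

Lemma fscaleDl a b s : teq (fscale (a + b) s) (fscale a s ++ fscale b s).
Proof.
elim: s => [|[u v] s IH] /=; first exact: teq_refl.
apply: (teq_trans (t := [:: (a *: u, v); (b *: u, v)]
                        ++ (fscale a s ++ fscale b s))).
  rewrite -cat1s; apply: teq_cat => //; rewrite scalerDl; exact: teq_Dl.
rewrite /= -(cat1s (a *: u, v)) -(cat1s (a *: u, v) (_ ++ _)).
apply: teq_cat; first exact: teq_refl.
rewrite -cat1s -(cat1s (b *: u, v) (fscale b s)) !catA.
apply: teq_cat; [exact: teq_catC | exact: teq_refl].
Qed.

Lemma fscale0 s : teq (fscale 0 s) [::].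
Proof.
elim: s => [|[u v] s IH] /=; first exact: teq_refl.
rewrite scale0r -cat1s -(cats0 [::]); apply: teq_cat => //; exact: teq_0.
Qed.

Lemma fscale1 s : fscale 1 s = s.
Proof. by elim: s => [|[u v] s IH] //=; rewrite scale1r IH. Qed.

Lemma taddN : left_inverse tzero (tscale (-1)) tadd.
Proof.
elim/quotW=> s; rewrite (tscale_pi _ s) tadd_pi; apply/pi_teq.
rewrite -{2}[s]fscale1; apply: teq_trans (fscale0 s); apply: teq_sym.
by rewrite -(addNr 1); apply: fscaleDl.
Qed.

HB.instance Definition _ := GRing.isZmodule.Build T taddA taddC tadd0 taddN.

Lemma tscaleA a b x : tscale a (tscale b x) = tscale (a * b) x.
Proof.
elim/quotW: x => s; rewrite (tscale_pi b s) (tscale_pi a) (tscale_pi (a * b) s) /fscale -map_comp; congr (\pi_T _).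
by apply: eq_map => p /=; rewrite scalerA.
Qed.

Lemma tscale1 : left_id 1 tscale.
Proof. by elim/quotW=> s; rewrite tscale_pi fscale1. Qed.

Lemma tscaleDr : right_distributive tscale +%R.
Proof.
move=> a; elim/quotW=> s; elim/quotW=> t.
rewrite /GRing.add /= (tadd_pi s t) (tscale_pi a (s ++ t)) (tscale_pi a s) (tscale_pi a t).
by rewrite tadd_pi /fscale map_cat.
Qed.

Lemma tscaleDl x : {morph tscale^~ x : a b / a + b}.
Proof.
elim/quotW: x => s a b; rewrite {2}/GRing.add /=.
rewrite (tscale_pi a s) (tscale_pi b s) (tscale_pi _ s) tadd_pi.
by apply/pi_teq; apply: fscaleDl.
Qed.

HB.instance Definition _ := GRing.Zmodule_isLmodule.Build k T
  tscaleA tscale1 tscaleDr tscaleDl.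

Definition tens (u : U) (v : V) : T := \pi_T [:: (u, v)].

(* Sweedler sums: [tsum f x] is the sum of f u v over the chosen expression of
   x as a formal sum of pure tensors. For bilinear f it is the value at x of
   the linear map on U ⊗ V induced by f, independently of the choice. *)
Definition tsum (W : nmodType) (f : U -> V -> W) (x : T) : W :=
  \sum_(p <- repr x) f p.1 p.2.

End TensorSpace.

Notation "u ⊗ v" := (tens u v) (at level 40, left associativity) : tensor_scope.
Notation "\tsum_ ( u ⊗ v <- x ) e" := (tsum (fun u v => e) x)
  (at level 41, u name, v name, x at level 60, e at level 41,
   format "\tsum_ ( u  ⊗  v  <-  x )  e") : tensor_scope.
Local Open Scope tensor_scope.

Section TensorTheory.
Variables (k : fieldType).
Implicit Types (U V W : lmodType k).

Definition bilin U V W (f : U -> V -> W) :=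
  (forall v, linear (f^~ v)) /\ (forall u, linear (f u)).

Lemma tens_bilinear U V : bilin (@tens k U V).
Proof.
have tD (x y : seq (U * V)) : \pi_(tensor U V) x + \pi_(tensor U V) y = \pi_(tensor U V) (x ++ y).
  exact: tadd_pi.
have tZ a (x : seq (U * V)) : a *: \pi_(tensor U V) x = \pi_(tensor U V) (fscale a x).
  exact: tscale_pi.
split=> [v a u u' | u a v v']; rewrite /tens tZ tD; apply/pi_teq.
  exact: teq_Dl.
apply: teq_trans (teq_Dr _ _ _) _.
rewrite -cat1s; apply: (teq_cat (s' := [:: _]) _ (teq_refl _)).
by apply: teq_sym; apply: teq_Z.
Qed.

Lemma tsum_pi U V (W : lmodType k) (f : U -> V -> W) s :
  bilin f -> tsum f (\pi_(tensor U V) s) = \sum_(p <- s) f p.1 p.2.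
Proof.
move=> [fl fr]; rewrite /tsum.
have fD u u' v : f (u + u') v = f u v + f u' v.
  by have := fl v 1 u u'; rewrite !scale1r.
have f0 v : f 0 v = 0 by apply: (addIr (f 0 v)); rewrite -fD !add0r.
have fD' u v v' : f u (v + v') = f u v + f u v'.
  by have := fr u 1 v v'; rewrite !scale1r.
have f0' u : f u 0 = 0 by apply: (addIr (f u 0)); rewrite -fD' !add0r.
have fZ a u v : f (a *: u) v = a *: f u v.
  by have := fl v a u 0; rewrite !addr0 f0 addr0.
have fZ' a u v : f u (a *: v) = a *: f u v.
  by have := fr u a v 0; rewrite !addr0 f0' addr0.
move: (repr (\pi_(tensor U V) s)) (repr_teq s) => t; elim=> {s t} //.
- by move=> ? ? ? _ -> _ ->.
- by move=> ? ? ? ? _ h1 _ h2; rewrite !big_cat /= h1 h2.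
- by move=> ? ?; rewrite !big_cat /= addrC.
- by move=> v; rewrite big_seq1 big_nil /= f0.
- by move=> u u' v; rewrite big_seq1 big_cons big_seq1 /= fD.
- by move=> u v v'; rewrite big_seq1 big_cons big_seq1 /= fD'.
- by move=> a u v; rewrite !big_seq1 /= fZ fZ'.
Qed.

Lemma tsum_tens U V W (f : U -> V -> W) u v :
  bilin f -> tsum f (u ⊗ v) = f u v.
Proof. by move=> fb; rewrite /tens tsum_pi // big_seq1. Qed.

Lemma tsum_linear U V W (f : U -> V -> W) :
  bilin f -> linear (tsum f).
Proof.
move=> fb a; elim/quotW=> s; elim/quotW=> t.
have -> : a *: \pi_(tensor U V) s + \pi_(tensor U V) t
          = \pi_(tensor U V) (fscale a s ++ t).
  by rewrite -tadd_pi -tscale_pi.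
rewrite !tsum_pi // big_cat /= big_map scaler_sumr; congr (_ + _).
apply: eq_bigr => p _ /=; have [fl _] := fb.
have f0 : f 0 p.2 = 0.
  by have := fl p.2 1 0 0; rewrite !scale1r addr0 => /(canLR (addrK _)); rewrite subrr.
by have := fl p.2 a p.1 0; rewrite !addr0 f0 addr0.
Qed.

Lemma linear_tsum U V W W' (g : W -> W') (f : U -> V -> W) x :
  linear g -> g (tsum f x) = tsum (fun u v => g (f u v)) x.
Proof.
move=> gl; rewrite /tsum; elim: (repr x) => [|p s IH].
  rewrite !big_nil; apply: (addIr (g 0)); rewrite add0r.
  by have := gl 1 0 0; rewrite !scale1r addr0 => <-.
by rewrite !big_cons -IH; have := gl 1 (f p.1 p.2); rewrite scale1r => ->; rewrite scale1r.
Qed.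

Lemma tsum_id U V (x : tensor U V) : \tsum_(u ⊗ v <- x) (u ⊗ v) = x.
Proof.
rewrite /tsum -[RHS]reprK; elim: (repr x) => [|[u v] s IH].
  by rewrite big_nil.
by rewrite big_cons IH /= -cat1s; apply: tadd_pi.
Qed.

Lemma eq_tsum U V (W : nmodType) (f g : U -> V -> W) x :
  f =2 g -> tsum f x = tsum g x.
Proof. by move=> fg; apply: eq_bigr => p _; apply: fg. Qed.

Definition tmap U V U' V' (f : U -> U') (g : V -> V') (x : tensor U V) :
  tensor U' V' := \tsum_(u ⊗ v <- x) (f u ⊗ g v).

Lemma tmap_bilinear U V U' V' (f : U -> U') (g : V -> V') :
  linear f -> linear g -> bilin (fun u v => f u ⊗ g v).
Proof.
move=> fl gl; have [tl tr] := @tens_bilinear U' V'.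
by split=> [v a u u' | u a v v']; rewrite (fl, gl) (tl, tr).
Qed.

Lemma tmap_tens U V U' V' (f : U -> U') (g : V -> V') u v :
  linear f -> linear g -> tmap f g (u ⊗ v) = f u ⊗ g v.
Proof. by move=> fl gl; apply: tsum_tens; apply: tmap_bilinear. Qed.

Lemma tmap_linear U V U' V' (f : U -> U') (g : V -> V') :
  linear f -> linear g -> linear (tmap f g).
Proof. by move=> fl gl; apply/tsum_linear/tmap_bilinear. Qed.

Lemma tmap_id U V (x : tensor U V) : tmap id id x = x.
Proof. exact: tsum_id. Qed.

Lemma tmap_comp U V U' V' U'' V'' (f : U -> U') (g : V -> V')
    (f' : U' -> U'') (g' : V' -> V'') (x : tensor U V) :
  linear f' -> linear g' ->
  tmap f' g' (tmap f g x) = tmap (f' \o f) (g' \o g) x.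
Proof.
move=> fl gl; rewrite {2}/tmap linear_tsum; last exact: tmap_linear.
by apply: eq_tsum => u v; rewrite tmap_tens.
Qed.

(* The (suppressed) associativity constraint of vector spaces and its inverse *)
Definition tassoc U V W (x : tensor (tensor U V) W) : tensor U (tensor V W) :=
  \tsum_(y ⊗ w <- x) \tsum_(u ⊗ v <- y) (u ⊗ (v ⊗ w)).
Definition tassocV U V W (x : tensor U (tensor V W)) : tensor (tensor U V) W :=
  \tsum_(u ⊗ y <- x) \tsum_(v ⊗ w <- y) ((u ⊗ v) ⊗ w).

End TensorTheory.

(* Bijectivity of the antipode is not part of the structure. *)
HB.mixin Record isHopf (k : fieldType) H of GRing.Algebra k H := {
  hdelta : H -> tensor H H;
  heps : H -> k;
  antipode : H -> H;
  hdelta_linear : linear hdelta;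
  heps_linear : scalar heps;
  antipode_linear : linear antipode;
  hdelta_coassoc : forall h,
    \tsum_(h12 ⊗ h3 <- hdelta h) \tsum_(h1 ⊗ h2 <- hdelta h12)
      (h1 ⊗ (h2 ⊗ h3))
    = \tsum_(h1 ⊗ h23 <- hdelta h) (h1 ⊗ hdelta h23);
  hdelta_counitl : forall h, \tsum_(h1 ⊗ h2 <- hdelta h) (heps h1 *: h2) = h;
  hdelta_counitr : forall h, \tsum_(h1 ⊗ h2 <- hdelta h) (heps h2 *: h1) = h;
  hdelta1 : hdelta 1 = 1 ⊗ 1;
  hdeltaM : forall g h,
    hdelta (g * h) = \tsum_(g1 ⊗ g2 <- hdelta g) \tsum_(h1 ⊗ h2 <- hdelta h)
                       ((g1 * h1) ⊗ (g2 * h2));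
  heps1 : heps 1 = 1;
  hepsM : forall g h, heps (g * h) = heps g * heps h;
  antipodel : forall h,
    \tsum_(h1 ⊗ h2 <- hdelta h) (antipode h1 * h2) = (heps h)%:A;
  antipoder : forall h,
    \tsum_(h1 ⊗ h2 <- hdelta h) (h1 * antipode h2) = (heps h)%:A
}.

#[short(type="hopfAlgType")]
HB.structure Definition HopfAlg (k : fieldType) :=
  {H of isHopf k H & GRing.Algebra k H}.

Record is_hopf_aut (k : fieldType) (H : hopfAlgType k) (f : H -> H) : Prop :=
  IsHopfAut {
    ha_bij : bijective f;
    ha_linear : linear f;
    ha_1 : f 1 = 1;
    ha_M : {morph f : g h / g * h};
    ha_delta : forall h, hdelta (f h) = tmap f f (hdelta h);
    ha_eps : forall h, heps (f h) = heps h;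
    ha_antipode : forall h, antipode (f h) = f (antipode h)
  }.

Section HopfAut.
Variables (k : fieldType) (H : hopfAlgType k).

Record hopfAut := HopfAut {
  hopf_aut_fun :> H -> H;
  hopf_autP : is_hopf_aut hopf_aut_fun
}.

Lemma hopf_aut_ext (f g : hopfAut) : f =1 g -> f = g.
Proof.
case: f g => [f fP] [g gP] /= /funext fg.
by case: _ / fg in gP *; congr HopfAut.
Qed.

Lemma hopf_aut_id : is_hopf_aut (@id H).
Proof.
split=> //; first by exists id.
by move=> h; rewrite tmap_id.
Qed.

Lemma hopf_aut_comp (f g : hopfAut) : is_hopf_aut (f \o g).
Proof.
have [fb fl f1 fM fD fe fS] := hopf_autP f.
have [gb gl g1 gM gD ge gS] := hopf_autP g.
split=> /=.
- exact: bij_comp.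
- by move=> a x y /=; rewrite gl fl.
- by rewrite g1 f1.
- by move=> x y /=; rewrite gM fM.
- by move=> h; rewrite fD gD tmap_comp.
- by move=> h; rewrite fe ge.
- by move=> h; rewrite fS gS.
Qed.

Lemma hopf_aut_has_inv (f : hopfAut) :
  exists g : H -> H, cancel f g /\ cancel g f.
Proof. by have [[g fK gK]] := hopf_autP f; exists g. Qed.

Definition hopf_aut_inv_fun (f : hopfAut) : H -> H :=
  projT1 (cid (hopf_aut_has_inv f)).

Lemma hopf_autK (f : hopfAut) : cancel f (hopf_aut_inv_fun f).
Proof. by have [] := projT2 (cid (hopf_aut_has_inv f)). Qed.

Lemma hopf_autVK (f : hopfAut) : cancel (hopf_aut_inv_fun f) f.
Proof. by have [] := projT2 (cid (hopf_aut_has_inv f)). Qed.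

Lemma hopf_aut_inv (f : hopfAut) : is_hopf_aut (hopf_aut_inv_fun f).
Proof.
have [fb fl f1 fM fD fe fS] := hopf_autP f.
have fK := hopf_autK f; have gK := hopf_autVK f; set g := hopf_aut_inv_fun f in fK gK *.
have gl : linear g by move=> a x y; apply: (can_inj fK); rewrite fl !gK.
split=> //.
- by exists f.
- by rewrite -[in LHS]f1 fK.
- by move=> x y; apply: (can_inj fK); rewrite fM !gK.
- move=> h; rewrite -{2}(gK h) fD tmap_comp //.
  by rewrite (_ : g \o f = id) ?tmap_id //; apply/funext => x /=; rewrite fK.
- by move=> h; rewrite -[in RHS](gK h) fe.
- by move=> h; apply: (can_inj fK); rewrite -fS !gK.
Qed.

HB.instance Definition _ := gen_eqMixin hopfAut.
HB.instance Definition _ := gen_choiceMixin hopfAut.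

Definition hopf_aut_mul (f g : hopfAut) := HopfAut (hopf_aut_comp f g).
Definition hopf_aut_one := HopfAut hopf_aut_id.
Definition hopf_aut_V (f : hopfAut) := HopfAut (hopf_aut_inv f).

Lemma hopf_aut_mulA : associative hopf_aut_mul.
Proof. by move=> f g h; apply: hopf_aut_ext. Qed.
Lemma hopf_aut_mul1 : left_id hopf_aut_one hopf_aut_mul.
Proof. by move=> f; apply: hopf_aut_ext. Qed.
Lemma hopf_aut_1mul : right_id hopf_aut_one hopf_aut_mul.
Proof. by move=> f; apply: hopf_aut_ext. Qed.
Lemma hopf_aut_mulV : left_inverse hopf_aut_one hopf_aut_V hopf_aut_mul.
Proof. by move=> f; apply: hopf_aut_ext => x /=; rewrite hopf_autK. Qed.
Lemma hopf_aut_Vmul : right_inverse hopf_aut_one hopf_aut_V hopf_aut_mul.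
Proof. by move=> f; apply: hopf_aut_ext => x /=; rewrite hopf_autVK. Qed.

HB.instance Definition _ := isGroup.Build hopfAut
  hopf_aut_mulA hopf_aut_mul1 hopf_aut_1mul hopf_aut_mulV hopf_aut_Vmul.

End HopfAut.

Section LRGroup.
Variables (k : fieldType) (H1 H2 : hopfAlgType k).
Local Open Scope group_scope.

Record LRgroup := LRG {
  lrα : hopfAut H1;
  lrβ : hopfAut H1;
  lrγ : hopfAut H2;
  lrδ : hopfAut H2
}.

HB.instance Definition _ := gen_eqMixin LRgroup.
HB.instance Definition _ := gen_choiceMixin LRgroup.

Definition LRgroup_mul (x y : LRgroup) : LRgroup :=
  let: LRG α1 β1 γ1 δ1 := x in
  let: LRG α2 β2 γ2 δ2 := y in
  LRG (α2 * α1) (α2 * β1 * α2^-1 * β2) (γ1 * γ2) (δ2 * γ2^-1 * δ1 * γ2).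
Definition LRgroup_one : LRgroup := LRG 1 1 1 1.
Definition LRgroup_inv (x : LRgroup) : LRgroup :=
  let: LRG α β γ δ := x in
  LRG α^-1 (α^-1 * β^-1 * α) γ^-1 (γ * δ^-1 * γ^-1).

Lemma LRgroup_mulA : associative LRgroup_mul.
Proof.
by move=> [a1 b1 c1 d1] [a2 b2 c2 d2] [a3 b3 c3 d3]; congr LRG; rewrite
  ?(invgM, mulgA, mulgVK, mulgK, mulgV, mulVg, mul1g, mulg1, invgK, invg1).
Qed.
Lemma LRgroup_mul1 : left_id LRgroup_one LRgroup_mul.
Proof. by move=> [a b c d]; congr LRG; rewrite
  ?(invgM, mulgA, mulgVK, mulgK, mulgV, mulVg, mul1g, mulg1, invgK, invg1). Qed.
Lemma LRgroup_1mul : right_id LRgroup_one LRgroup_mul.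
Proof. by move=> [a b c d]; congr LRG; rewrite
  ?(invgM, mulgA, mulgVK, mulgK, mulgV, mulVg, mul1g, mulg1, invgK, invg1). Qed.
Lemma LRgroup_mulV : left_inverse LRgroup_one LRgroup_inv LRgroup_mul.
Proof. by move=> [a b c d]; congr LRG; rewrite
  ?(invgM, mulgA, mulgVK, mulgK, mulgV, mulVg, mul1g, mulg1, invgK, invg1). Qed.
Lemma LRgroup_Vmul : right_inverse LRgroup_one LRgroup_inv LRgroup_mul.
Proof. by move=> [a b c d]; congr LRG; rewrite
  ?(invgM, mulgA, mulgVK, mulgK, mulgV, mulVg, mul1g, mulg1, invgK, invg1). Qed.

HB.instance Definition _ := isGroup.Build LRgroup
  LRgroup_mulA LRgroup_mul1 LRgroup_1mul LRgroup_mulV LRgroup_Vmul.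

End LRGroup.

Declare Scope cat_scope.
Delimit Scope cat_scope with cat.

Record category := Category {
  ob :> Type;
  hom : ob -> ob -> Type;
  idm : forall U, hom U U;
  compm : forall U V W, hom V W -> hom U V -> hom U W;
  comp1m : forall U V (f : hom U V), compm (idm V) f = f;
  compm1 : forall U V (f : hom U V), compm f (idm U) = f;
  compmA : forall U V W X (h : hom W X) (g : hom V W) (f : hom U V),
    compm h (compm g f) = compm (compm h g) f
}.
Arguments hom {c} _ _.
Arguments idm {c} U.
Arguments compm {c U V W} _ _.
Notation "g ∘ f" := (compm g f) (at level 42, right associativity) : cat_scope.
Local Open Scope cat_scope.

Definition is_iso (C : category) (U V : C) (f : hom U V) : Prop :=
  exists g : hom V U, g ∘ f = idm U /\ f ∘ g = idm V.

(* A morphism together with its source and target: equations between morphisms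
   whose sources and targets are equal objects, but not convertible ones, are
   stated in this type. *)
Record arrow (C : category) := Arrow {
  source : C;
  target : C;
  arr : hom source target
}.
Arguments Arrow {C source target} arr.

Record functor (C D : category) := Functor {
  fob :> C -> D;
  fmap : forall U V, hom U V -> hom (fob U) (fob V);
  fmap1 : forall U, fmap (idm U) = idm (fob U);
  fmapM : forall U V W (g : hom V W) (f : hom U V),
    fmap (g ∘ f) = fmap g ∘ fmap f
}.
Arguments fmap {C D} F {U V} _ : rename.

Definition id_functor (C : category) : functor C C :=
  @Functor C C id (fun _ _ f => f) (fun _ => erefl) (fun _ _ _ _ _ => erefl).

Section CompFunctor.
Variables (C D E : category) (G : functor D E) (F : functor C D).
Lemma comp_functor1 U : fmap G (fmap F (idm U)) = idm (G (F U)).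
Proof. by rewrite !fmap1. Qed.
Lemma comp_functorM U V W (g : hom V W) (f : hom U V) :
  fmap G (fmap F (g ∘ f)) = fmap G (fmap F g) ∘ fmap G (fmap F f).
Proof. by rewrite !fmapM. Qed.
Definition comp_functor : functor C E :=
  @Functor C E (fun U => G (F U)) (fun _ _ f => fmap G (fmap F f))
    comp_functor1 comp_functorM.
End CompFunctor.

Section ProdCategory.
Variables C D : category.
Let phom (U V : C * D) : Type := (hom U.1 V.1 * hom U.2 V.2)%type.
Let pid (U : C * D) : phom U U := (idm U.1, idm U.2).
Let pcomp (U V W : C * D) (g : phom V W) (f : phom U V) : phom U W :=
  (g.1 ∘ f.1, g.2 ∘ f.2).
Lemma prod_comp1m (U V : C * D) (f : phom U V) : pcomp (pid V) f = f.
Proof. by case: f => f g; rewrite /pcomp /= !comp1m. Qed.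
Lemma prod_compm1 (U V : C * D) (f : phom U V) : pcomp f (pid U) = f.
Proof. by case: f => f g; rewrite /pcomp /= !compm1. Qed.
Lemma prod_compmA (U V W X : C * D) (h : phom W X) (g : phom V W)
  (f : phom U V) : pcomp h (pcomp g f) = pcomp (pcomp h g) f.
Proof. by rewrite /pcomp /= !compmA. Qed.
Definition prod_category : category :=
  Category prod_comp1m prod_compm1 prod_compmA.
End ProdCategory.

Section ProdFunctor.
Variables (C D C' D' : category) (F : functor C C') (F' : functor D D').
Let pF (U : prod_category C D) : prod_category C' D' := (F U.1, F' U.2).
Let pFm (U V : prod_category C D) (f : hom U V) : hom (pF U) (pF V) :=
  (fmap F f.1, fmap F' f.2).
Lemma prod_functor1 U : pFm (idm U) = idm (pF U).
Proof. by rewrite /pFm /= !fmap1. Qed.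
Lemma prod_functorM U V W (g : hom V W) (f : hom U V) :
  pFm (g ∘ f) = pFm g ∘ pFm f.
Proof. by rewrite /pFm /= !fmapM. Qed.
Definition prod_functor : functor (prod_category C D) (prod_category C' D') :=
  Functor prod_functor1 prod_functorM.
End ProdFunctor.

(* The components of a braided T-category over G, before any axiom: t_deg V is
   the index a such that V lies in the component C_a, t_conj is the conjugation
   and t_assocV is the inverse of the associativity constraint. The constraints
   of the monoidal category, which are identities when it is strict, are kept
   explicit because tensor products of vector spaces are associative only up to
   the canonical isomorphism. *)
Record tcat_data (G : groupType) := TCatData {
  t_cat :> category;
  t_tens : functor (prod_category t_cat t_cat) t_cat;
  t_unit : t_cat;
  t_assoc : forall U V W : t_cat,
    hom (t_tens (t_tens (U, V), W)) (t_tens (U, t_tens (V, W)));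
  t_assocV : forall U V W : t_cat,
    hom (t_tens (U, t_tens (V, W))) (t_tens (t_tens (U, V), W));
  t_lunit : forall U : t_cat, hom (t_tens (t_unit, U)) U;
  t_runit : forall U : t_cat, hom (t_tens (U, t_unit)) U;
  t_deg : t_cat -> G;
  t_conj : G -> functor t_cat t_cat;
  t_braid : forall U V : t_cat,
    hom (t_tens (U, V)) (t_tens (t_conj (t_deg U) V, U))
}.

Definition t_tensm (G : groupType) (C : tcat_data G) (U U' V V' : C)
    (f : hom U U') (g : hom V V') : hom (t_tens C (U, V)) (t_tens C (U', V')) :=
  @fmap _ _ (t_tens C) (U, V) (U', V') (f, g).

Section TCategory.
Variables (G : groupType) (C : tcat_data G).

Local Notation "U ⊠ V" := (t_tens C (U, V)) (at level 40, left associativity).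
Local Notation "f ⊠m g" := (t_tensm f g) (at level 40, left associativity).
Local Notation "'𝟙'" := (t_unit C).
Local Notation α := (@t_assoc G C).
Local Notation α' := (@t_assocV G C).
Local Notation λ := (@t_lunit G C).
Local Notation ρ := (@t_runit G C).
Local Notation φ := (@t_conj G C).
Local Notation deg := (@t_deg G C).
Local Notation c := (@t_braid G C).

Record is_monoidal : Prop := IsMonoidal {
  assoc_nat : forall (U U' V V' W W' : C)
      (f : hom U U') (g : hom V V') (h : hom W W'),
    (f ⊠m (g ⊠m h)) ∘ α U V W = α U' V' W' ∘ ((f ⊠m g) ⊠m h);
  assocK : forall U V W : C, α' U V W ∘ α U V W = idm ((U ⊠ V) ⊠ W);
  assocVK : forall U V W : C, α U V W ∘ α' U V W = idm (U ⊠ (V ⊠ W));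
  lunit_nat : forall (U V : C) (f : hom U V),
    f ∘ λ U = λ V ∘ (idm 𝟙 ⊠m f);
  lunit_iso : forall U : C, is_iso (λ U);
  runit_nat : forall (U V : C) (f : hom U V),
    f ∘ ρ U = ρ V ∘ (f ⊠m idm 𝟙);
  runit_iso : forall U : C, is_iso (ρ U);
  pentagon : forall U V W X : C,
    α U V (W ⊠ X) ∘ α (U ⊠ V) W X
    = (idm U ⊠m α V W X) ∘ α U (V ⊠ W) X ∘ (α U V W ⊠m idm X);
  triangle : forall U V : C,
    (idm U ⊠m λ V) ∘ α U 𝟙 V = ρ U ⊠m idm V
}.

Record strict_tensor_functor (F : functor C C) : Prop := StrictTensorFunctor {
  (* Leibniz equality of functors: agreement on objects and on morphisms *)
  stf_tens : comp_functor F (t_tens C)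
           = comp_functor (t_tens C) (prod_functor F F);
  stf_unit : F 𝟙 = 𝟙;
  stf_assoc : forall U V W : C,
    Arrow (fmap F (α U V W)) = Arrow (α (F U) (F V) (F W));
  stf_lunit : forall U : C, Arrow (fmap F (λ U)) = Arrow (λ (F U));
  stf_runit : forall U : C, Arrow (fmap F (ρ U)) = Arrow (ρ (F U))
}.

(* By conj1 and conjM each φ a is invertible, with inverse φ a^-1, and φ is a
   group homomorphism to the strict tensor automorphisms of C. *)
Record is_crossed : Prop := IsCrossed {
  hom_deg : forall (U V : C), hom U V -> deg U = deg V;
  tens_deg : forall U V : C, deg (U ⊠ V) = (deg U * deg V)%g;
  conj_strict : forall a : G, strict_tensor_functor (φ a);
  conj1 : φ 1%g = id_functor C;
  conjM : forall a b : G, φ (a * b)%g = comp_functor (φ a) (φ b);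
  conj_deg : forall (b a : G) (V : C),
    (exists2 U : C, deg U = a & φ b U = V) <-> deg V = (b * a * b^-1)%g
}.

Record is_braided : Prop := IsBraided {
  braid_iso : forall U V : C, is_iso (c U V);
  braid_nat : forall (U U' V V' : C) (f : hom U U') (g : hom V V'),
    Arrow ((fmap (φ (deg U)) g ⊠m f) ∘ c U V)
    = Arrow (c U' V' ∘ (f ⊠m g));
  braid_tensl : forall U V W : C,
    Arrow (c (U ⊠ V) W)
    = Arrow (α _ _ _ ∘ (c U (φ (deg V) W) ⊠m idm V) ∘ α' _ _ _
             ∘ (idm U ⊠m c V W) ∘ α U V W);
  braid_tensr : forall U V W : C,
    Arrow (c U (V ⊠ W))
    = Arrow (α' _ _ _ ∘ (idm (φ (deg U) V) ⊠m c U W) ∘ α _ _ _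
             ∘ (c U V ⊠m idm W) ∘ α' U V W);
  braid_conj : forall (a : G) (U V : C),
    Arrow (fmap (φ a) (c U V)) = Arrow (c (φ a U) (φ a V))
}.

Record braided_T_category : Prop := BraidedTCategory {
  btc_monoidal : is_monoidal;
  btc_crossed : is_crossed;
  btc_braided : is_braided
}.

End TCategory.

Section LR.
Variables (k : fieldType) (H1 H2 : hopfAlgType k).

(* A vector space with an index in G and structure maps, without axioms *)
Record LRpre := LRPre {
  LRspace :> lmodType k;
  LRdeg : LRgroup H1 H2;
  lact : H1 -> LRspace -> LRspace;
  ract : LRspace -> H2 -> LRspace;
  lcoact : LRspace -> tensor H1 LRspace;
  rcoact : LRspace -> tensor LRspace H2
}.
Arguments lact {l} _ _.
Arguments ract {l} _ _.
Arguments lcoact {l} _.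
Arguments rcoact {l} _.

Local Notation "h ▷ m" := (lact h m) (at level 38, right associativity).
Local Notation "m ◁ h" := (ract m h) (at level 39, left associativity).

Record is_LR (M : LRpre) : Prop := IsLR {
  lact_bilin : bilin (@lact M);
  lact1 : forall m : M, 1 ▷ m = m;
  lactM : forall (g h : H1) (m : M), (g * h) ▷ m = g ▷ (h ▷ m);
  ract_bilin : bilin (@ract M);
  ract1 : forall m : M, m ◁ 1 = m;
  ractM : forall (g h : H2) (m : M), m ◁ (g * h) = (m ◁ g) ◁ h;
  lract : forall (h' : H1) (m : M) (h'' : H2),
    (h' ▷ m) ◁ h'' = h' ▷ (m ◁ h'');
  lcoact_linear : linear (@lcoact M);
  lcoact_counit : forall m : M, \tsum_(a ⊗ m0 <- lcoact m) (heps a *: m0) = m;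
  lcoact_coassoc : forall m : M,
    \tsum_(a ⊗ m0 <- lcoact m) \tsum_(a1 ⊗ a2 <- hdelta a) (a1 ⊗ (a2 ⊗ m0))
    = \tsum_(a ⊗ m0 <- lcoact m) (a ⊗ lcoact m0);
  rcoact_linear : linear (@rcoact M);
  rcoact_counit : forall m : M, \tsum_(m0 ⊗ b <- rcoact m) (heps b *: m0) = m;
  rcoact_coassoc : forall m : M,
    \tsum_(m0 ⊗ b <- rcoact m) \tsum_(b1 ⊗ b2 <- hdelta b) ((m0 ⊗ b1) ⊗ b2)
    = \tsum_(m0 ⊗ b <- rcoact m) (rcoact m0 ⊗ b);
  lrcoact : forall m : M,
    \tsum_(a ⊗ m0 <- lcoact m) (a ⊗ rcoact m0)
    = \tsum_(m0 ⊗ b <- rcoact m) \tsum_(a ⊗ m00 <- lcoact m0) (a ⊗ (m00 ⊗ b));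
  LR_left : let α := lrα (LRdeg M) in let β := lrβ (LRdeg M) in
    forall (h : H1) (m : M),
    \tsum_(h1 ⊗ h2 <- hdelta h) \tsum_(a ⊗ m0 <- lcoact m)
      ((α h1 * a) ⊗ (h2 ▷ m0))
    = \tsum_(h1 ⊗ h2 <- hdelta h) \tsum_(a ⊗ m0 <- lcoact (h1 ▷ m))
      ((a * β h2) ⊗ m0);
  LR_left_right : forall (h : H1) (m : M),
    rcoact (h ▷ m) = \tsum_(m0 ⊗ b <- rcoact m) ((h ▷ m0) ⊗ b);
  LR_right : let γ := lrγ (LRdeg M) in let δ := lrδ (LRdeg M) in
    forall (h : H2) (m : M),
    \tsum_(h1 ⊗ h2 <- hdelta h) \tsum_(m0 ⊗ b <- rcoact m)
      ((m0 ◁ h1) ⊗ (b * δ h2))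
    = \tsum_(h1 ⊗ h2 <- hdelta h) \tsum_(m0 ⊗ b <- rcoact (m ◁ h2))
      (m0 ⊗ (γ h1 * b));
  LR_right_left : forall (h : H2) (m : M),
    lcoact (m ◁ h) = \tsum_(a ⊗ m0 <- lcoact m) (a ⊗ (m0 ◁ h))
}.

Record is_LRhom (M N : LRpre) (f : M -> N) : Prop := IsLRhom {
  LRhom_deg : LRdeg M = LRdeg N;
  LRhom_linear : linear f;
  LRhom_lact : forall h m, f (h ▷ m) = h ▷ f m;
  LRhom_ract : forall m h, f (m ◁ h) = f m ◁ h;
  LRhom_lcoact : forall m,
    lcoact (f m) = \tsum_(a ⊗ m0 <- lcoact m) (a ⊗ f m0);
  LRhom_rcoact : forall m,
    rcoact (f m) = \tsum_(m0 ⊗ b <- rcoact m) (f m0 ⊗ b)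
}.

Record LRobj := LRObj { LRpre_of :> LRpre; LRobjP : is_LR LRpre_of }.

Record LRhom (M N : LRobj) := LRHom {
  LRhom_fun :> M -> N;
  LRhomP : is_LRhom LRhom_fun
}.

Lemma LRhom_ext (M N : LRobj) (f g : LRhom M N) : f =1 g -> f = g.
Proof.
case: f g => [f fP] [g gP] /= /funext fg.
by case: _ / fg in gP *; congr LRHom.
Qed.

Lemma is_LRhom_id (M : LRpre) : is_LRhom (@id M).
Proof. by split=> // m; rewrite tsum_id. Qed.

Lemma is_LRhom_comp (M N P : LRpre) (g : N -> P) (f : M -> N) :
  is_LRhom g -> is_LRhom f -> is_LRhom (g \o f).
Proof.
move=> [gd gl gL gR gLc gRc] [fd fl fL fR fLc fRc]; split=> /=.
- by rewrite fd.
- by move=> a x y /=; rewrite fl gl.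
- by move=> h m; rewrite fL gL.
- by move=> m h; rewrite fR gR.
- move=> m; rewrite gLc fLc.
  by rewrite -/(tmap id g _) -/(tmap id f _) tmap_comp.
- move=> m; rewrite gRc fRc.
  by rewrite -/(tmap g id _) -/(tmap f id _) tmap_comp.
Qed.

Definition LRidm (M : LRobj) : LRhom M M := LRHom (is_LRhom_id M).
Definition LRcompm (M N P : LRobj) (g : LRhom N P) (f : LRhom M N) :
  LRhom M P := LRHom (is_LRhom_comp (LRhomP g) (LRhomP f)).

Lemma LRcomp1m M N (f : LRhom M N) : LRcompm (LRidm N) f = f.
Proof. exact: LRhom_ext. Qed.
Lemma LRcompm1 M N (f : LRhom M N) : LRcompm f (LRidm M) = f.
Proof. exact: LRhom_ext. Qed.
Lemma LRcompmA M N P Q (h : LRhom P Q) (g : LRhom N P) (f : LRhom M N) :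
  LRcompm h (LRcompm g f) = LRcompm (LRcompm h g) f.
Proof. exact: LRhom_ext. Qed.

Definition LRcat : category := Category LRcomp1m LRcompm1 LRcompmA.

Definition LRunit : LRpre := {|
  LRspace := k^o;
  LRdeg := 1%g;
  lact := fun (h : H1) (a : k^o) => heps h *: a;
  ract := fun (a : k^o) (h : H2) => heps h *: a;
  lcoact := fun a : k^o => 1 ⊗ a;
  rcoact := fun a : k^o => a ⊗ 1
|}.

Definition LRtens (M N : LRpre) : LRpre :=
  let β1 := lrβ (LRdeg M) in let δ1 := lrδ (LRdeg M) in
  let α2 := lrα (LRdeg N) in let γ2 := lrγ (LRdeg N) in {|
  LRspace := tensor M N;
  LRdeg := (LRdeg M * LRdeg N)%g;
  lact := fun h x =>
    \tsum_(m ⊗ n <- x) \tsum_(h1 ⊗ h2 <- hdelta h) ((h1 ▷ m) ⊗ (h2 ▷ n));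
  ract := fun x h =>
    \tsum_(m ⊗ n <- x) \tsum_(h1 ⊗ h2 <- hdelta h)
      ((m ◁ γ2 h1) ⊗ (n ◁ (γ2^-1 * δ1 * γ2)%g h2));
  lcoact := fun x =>
    \tsum_(m ⊗ n <- x) \tsum_(a ⊗ m0 <- lcoact m) \tsum_(b ⊗ n0 <- lcoact n)
      ((α2 a * (α2 * β1 * α2^-1)%g b) ⊗ (m0 ⊗ n0));
  rcoact := fun x =>
    \tsum_(m ⊗ n <- x) \tsum_(m0 ⊗ a <- rcoact m) \tsum_(n0 ⊗ b <- rcoact n)
      ((m0 ⊗ n0) ⊗ (a * b))
|}.

Definition LRconj (x : LRgroup H1 H2) (N : LRpre) : LRpre :=
  let α1 := lrα x in let β1 := lrβ x in
  let γ1 := lrγ x in let δ1 := lrδ x in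
  let α2 := lrα (LRdeg N) in let γ2 := lrγ (LRdeg N) in {|
  LRspace := N;
  LRdeg := (x * LRdeg N * x^-1)%g;
  lact := fun h (n : N) => (β1^-1 * α1)%g h ▷ n;
  ract := fun (n : N) h => n ◁ (γ2^-1 * δ1 * γ2 * γ1^-1)%g h;
  lcoact := fun n : N =>
    \tsum_(a ⊗ n0 <- lcoact n) ((α1^-1 * α2 * β1 * α2^-1)%g a ⊗ n0);
  rcoact := fun n : N =>
    \tsum_(n0 ⊗ b <- rcoact n) (n0 ⊗ (γ1 * δ1^-1)%g b)
|}.

Definition LRbraid (M N : LRpre) (x : LRtens M N) :
    LRtens (LRconj (LRdeg M) N) M :=
  let β1 := lrβ (LRdeg M) in let δ1 := lrδ (LRdeg M) in
  \tsum_(m ⊗ n <- x) \tsum_(a ⊗ m0 <- lcoact m) \tsum_(n0 ⊗ b <- rcoact n)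
    ((β1^-1%g a ▷ n0) ⊗ (m0 ◁ δ1^-1%g b)).

Definition LRlunit (M : LRpre) (x : LRtens LRunit M) : M :=
  tsum (fun (a : k^o) (m : M) => a *: m) x.
Definition LRrunit (M : LRpre) (x : LRtens M LRunit) : M :=
  tsum (fun (m : M) (a : k^o) => a *: m) x.

(* The operations above are well defined on LR(H1, H2): they yield objects of
   LR(H1, H2), respectively morphisms between the indicated objects. *)
Record LR_closed : Prop := LRClosed {
  cl_unit : is_LR LRunit;
  cl_tens : forall M N : LRobj, is_LR (LRtens M N);
  cl_conj : forall (x : LRgroup H1 H2) (N : LRobj), is_LR (LRconj x N);
  cl_tensm : forall (M M' N N' : LRobj) (f : LRhom M M') (g : LRhom N N'),
    @is_LRhom (LRtens M N) (LRtens M' N') (tmap f g);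
  cl_conjm : forall (x : LRgroup H1 H2) (N N' : LRobj) (f : LRhom N N'),
    @is_LRhom (LRconj x N) (LRconj x N') f;
  cl_assoc : forall M N P : LRobj,
    @is_LRhom (LRtens (LRtens M N) P) (LRtens M (LRtens N P)) (@tassoc k M N P);
  cl_assocV : forall M N P : LRobj,
    @is_LRhom (LRtens M (LRtens N P)) (LRtens (LRtens M N) P) (@tassocV k M N P);
  cl_lunit : forall M : LRobj, is_LRhom (@LRlunit M);
  cl_runit : forall M : LRobj, is_LRhom (@LRrunit M);
  cl_braid : forall M N : LRobj, is_LRhom (@LRbraid M N)
}.

Section LRData.
Hypothesis cl : LR_closed.

Let tob (p : prod_category LRcat LRcat) : LRcat :=
  LRObj (cl_tens cl p.1 p.2).
Let tmor (p q : prod_category LRcat LRcat) (f : hom p q) :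
  hom (tob p) (tob q) := @LRHom (tob p) (tob q) _ (cl_tensm cl f.1 f.2).

Lemma LRtens1 p : tmor (idm p) = idm (tob p).
Proof. by apply: LRhom_ext => x; apply: tmap_id. Qed.

Lemma LRtensM p q r (g : hom q r) (f : hom p q) :
  tmor (g ∘ f) = tmor g ∘ tmor f.
Proof.
apply: LRhom_ext => x; rewrite /= tmap_comp //.
  exact: LRhom_linear (LRhomP g.1).
exact: LRhom_linear (LRhomP g.2).
Qed.

Definition LRtens_functor : functor (prod_category LRcat LRcat) LRcat :=
  Functor LRtens1 LRtensM.

Let cob (x : LRgroup H1 H2) (N : LRcat) : LRcat := LRObj (cl_conj cl x N).
Let cmor x (N N' : LRcat) (f : hom N N') : hom (cob x N) (cob x N') :=
  @LRHom (cob x N) (cob x N') f (cl_conjm cl x f).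

Lemma LRconj_id x N : cmor x (idm N) = idm (cob x N).
Proof. exact: LRhom_ext. Qed.
Lemma LRconj_comp x N N' N'' (g : hom N' N'') (f : hom N N') :
  cmor x (g ∘ f) = cmor x g ∘ cmor x f.
Proof. exact: LRhom_ext. Qed.

Definition LRconj_functor (x : LRgroup H1 H2) : functor LRcat LRcat :=
  Functor (@LRconj_id x) (@LRconj_comp x).

Let uob : LRcat := LRObj (cl_unit cl).

Definition LRdata : tcat_data (LRgroup H1 H2) := {|
  t_cat := LRcat;
  t_tens := LRtens_functor;
  t_unit := uob;
  t_assoc := fun M N P : LRcat =>
    @LRHom (tob (tob (M, N), P)) (tob (M, tob (N, P))) _ (cl_assoc cl M N P);
  t_assocV := fun M N P : LRcat =>
    @LRHom (tob (M, tob (N, P))) (tob (tob (M, N), P)) _ (cl_assocV cl M N P);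
  t_lunit := fun M : LRcat => @LRHom (tob (uob, M)) M _ (cl_lunit cl M);
  t_runit := fun M : LRcat => @LRHom (tob (M, uob)) M _ (cl_runit cl M);
  t_deg := fun M : LRobj => LRdeg M;
  t_conj := LRconj_functor;
  t_braid := fun M N : LRcat =>
    @LRHom (tob (M, N)) (tob (cob (LRdeg (M : LRobj)) N, M)) _
      (cl_braid cl M N)
|}.

End LRData.
End LR.

(* Main.v *)
(* A sum [\tsum] over a tensor is a finite sum over one of its expressions: iterated
   sums commute, and a sum passes through every linear map. Each axiom of a Hopf
   algebra or of an object thus yields, by composition with an arbitrary multilinear
   function F, a rule for rewriting iterated sums of values of F; all identities
   between maps of tensor products are checked with these rules on pure tensors.

   The braiding combines a left Yetter-Drinfeld braiding over H1 with a right one over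
   H2; the two commute because the H1- and H2-structures do, and with the inverses S of
   the antipodes the inverse of c_{M,N} is
     n ⊗ m |-> m_(0) ◁ δ1^-1(S(n_[1])) ⊗ β1^-1(S(m_(-1))) ▷ n_[0].
   Conjugation does not change underlying spaces, so that strictness and the equalities
   of objects reduce to identities in Aut(H1) and Aut(H2). *)

Require Import Defs.
From mathcomp Require Import all_boot all_algebra.
From mathcomp Require Import boolp.

Set Implicit Arguments.
Unset Strict Implicit.
Unset Printing Implicit Defensive.

Import GRing.Theory.
Local Open Scope ring_scope.
Local Open Scope tensor_scope.

Local Notation "h ▷ m" := (lact h m) (at level 38, right associativity).
Local Notation "m ◁ h" := (ract m h) (at level 39, left associativity).

(** * Linearity of Sweedler expressions *)

Section Multilinear.
Variable k : fieldType.
Implicit Types (U V W X Y Z : lmodType k).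

Lemma eq_tsum_ptwise U V (W : nmodType) (f g : U -> V -> W) x :
  (forall u v, f u v = g u v) -> tsum f x = tsum g x.
Proof. exact: eq_tsum. Qed.

Lemma exchange_tsum U V X Y (W : nmodType) (F : U -> V -> X -> Y -> W) x y :
  \tsum_(u ⊗ v <- x) \tsum_(z ⊗ t <- y) F u v z t
  = \tsum_(z ⊗ t <- y) \tsum_(u ⊗ v <- x) F u v z t.
Proof. exact: exchange_big. Qed.

(** A named constant around [linear], so that [lin] can match a goal by its head symbol and recurse
    on the syntax of the function. *)
Definition islin U V (f : U -> V) : Prop := linear f.

Lemma bilinI U V W (F : U -> V -> W) :
  (forall v, islin (fun u => F u v)) -> (forall u, islin (fun v => F u v)) ->
  bilin F.
Proof. by []. Qed.

Definition trilin U V W X (F : U -> V -> W -> X) :=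
  [/\ forall v w, islin (fun u => F u v w), forall u w, islin (fun v => F u v w)
    & forall u v, islin (fun w => F u v w)].

Lemma lin_id U : islin (fun x : U => x).
Proof. by []. Qed.

Lemma lin_comp U V W (f : V -> W) (g : U -> V) :
  islin f -> islin g -> islin (fun x => f (g x)).
Proof. by move=> fl gl a x y; rewrite gl fl. Qed.

Lemma lin_tsum_body U V W X (F : X -> U -> V -> W) y :
  (forall u v, islin (fun x => F x u v)) -> islin (fun x => tsum (F x) y).
Proof.
move=> Fl a x z; rewrite /tsum scaler_sumr -big_split /=.
by apply: eq_bigr => p _; apply: Fl.
Qed.

Lemma lin_tsum_src U V W X (F : U -> V -> W) (g : X -> tensor U V) :
  bilin F -> islin g -> islin (fun x => tsum F (g x)).
Proof. by move=> Fb gl; apply: lin_comp gl; apply: tsum_linear. Qed.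

Lemma lin_tensl U V X (g : X -> U) (v : V) :
  islin g -> islin (fun x => g x ⊗ v).
Proof.
by move=> gl; apply: (lin_comp (f := fun u => u ⊗ v)) gl; exact: (tens_bilinear U V).1.
Qed.

Lemma lin_tensr U V X (g : X -> V) (u : U) :
  islin g -> islin (fun x => u ⊗ g x).
Proof.
by move=> gl; apply: (lin_comp (f := fun v => u ⊗ v)) gl; exact: (tens_bilinear U V).2.
Qed.

Lemma lin_scaler X V (g : X -> V) (c : k) :
  islin g -> islin (fun x => c *: g x).
Proof. by move=> gl a x y; rewrite gl scalerDr !scalerA mulrC. Qed.

Lemma lin_scalel X V (g : X -> k^o) (v : V) :
  islin g -> islin (fun x => (g x : k) *: v).
Proof. by move=> gl a x y; rewrite gl scalerDl -scalerA. Qed.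

Lemma lin_tsum U V W W' (g : W -> W') (f : U -> V -> W) x :
  islin g -> g (tsum f x) = tsum (fun u v => g (f u v)) x.
Proof. exact: linear_tsum. Qed.

(** Pure tensors span, by [tsum_id], and linear maps pass through the sum. This underlies
    [by_pure]. *)
Lemma tens_ext U V W (f g : tensor U V -> W) :
  islin f -> islin g -> (forall u v, f (u ⊗ v) = g (u ⊗ v)) -> forall x, f x = g x.
Proof.
move=> fl gl fg x; rewrite -[x]tsum_id lin_tsum // [RHS]lin_tsum //.
exact: eq_tsum_ptwise.
Qed.

End Multilinear.

(** * Linearity of the structure maps of Hopf algebras and objects *)

Section HopfLinear.
Variables (k : fieldType) (H : hopfAlgType k) (X : lmodType k).

Lemma lin_delta (g : X -> H) : islin g -> islin (fun x => hdelta (g x)).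
Proof. exact/lin_comp/hdelta_linear. Qed.

Lemma lin_antipode (g : X -> H) : islin g -> islin (fun x => antipode (g x)).
Proof. exact/lin_comp/antipode_linear. Qed.

Lemma lin_aut (f : hopfAut H) (g : X -> H) : islin g -> islin (fun x => f (g x)).
Proof. exact/lin_comp/(ha_linear (hopf_autP f)). Qed.

Lemma lin_mull (g : X -> H) (b : H) : islin g -> islin (fun x => g x * b).
Proof. by move=> gl a x y; rewrite gl mulrDl scalerAl. Qed.

Lemma lin_mulr (g : X -> H) (b : H) : islin g -> islin (fun x => b * g x).
Proof. by move=> gl a x y; rewrite gl mulrDr scalerAr. Qed.

Lemma lin_eps (V : lmodType k) (v : V) (g : X -> H) :
  islin g -> islin (fun x => heps (g x) *: v).
Proof.
move=> gl; apply: (@lin_scalel _ _ _ (fun x => heps (g x))).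
exact/(@lin_comp _ _ _ k^o)/gl/heps_linear.
Qed.
End HopfLinear.

Section LRLinear.
Variables (k : fieldType) (H1 H2 : hopfAlgType k) (X : lmodType k).
Implicit Types M N : LRobj H1 H2.

Lemma lin_lactl M (g : X -> H1) (m : M) :
  islin g -> islin (fun x => (g x) ▷ m).
Proof. exact/(@lin_comp _ _ _ _ (fun h => h ▷ m))/(lact_bilin (LRobjP M)).1. Qed.

Lemma lin_lactr M (h : H1) (g : X -> M) :
  islin g -> islin (fun x => h ▷ (g x)).
Proof. exact/lin_comp/(lact_bilin (LRobjP M)).2. Qed.

Lemma lin_ractl M (g : X -> M) (h : H2) :
  islin g -> islin (fun x => (g x) ◁ h).
Proof. exact/(@lin_comp _ _ _ _ (fun m => m ◁ h))/(ract_bilin (LRobjP M)).1. Qed.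

Lemma lin_ractr M (m : M) (g : X -> H2) :
  islin g -> islin (fun x => m ◁ g x).
Proof. exact/lin_comp/(ract_bilin (LRobjP M)).2. Qed.

Lemma lin_lcoact M (g : X -> M) : islin g -> islin (fun x => lcoact (g x)).
Proof. exact/lin_comp/(lcoact_linear (LRobjP M)). Qed.

Lemma lin_rcoact M (g : X -> M) : islin g -> islin (fun x => rcoact (g x)).
Proof. exact/lin_comp/(rcoact_linear (LRobjP M)). Qed.

Lemma lin_hom M N (f : LRhom M N) (g : X -> M) : islin g -> islin (fun x => f (g x)).
Proof. exact/lin_comp/(LRhom_linear (LRhomP f)). Qed.

End LRLinear.

(* A product elaborated under [\tsum] carries a ring structure that is convertible
   to the canonical one of [H] but not equal to it syntactically *)
Ltac hopf_of R := match R with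
  | context [?H] => lazymatch type of H with HopfAlg.type _ => H end end.

(* Linearity and multilinearity of Sweedler expressions, by recursion on their syntax;
   the last cases appeal to hypotheses on variable functions *)
Ltac lin :=
  cbv beta;
  lazymatch goal with
  | |- bilin _ => refine (bilinI _ _) => ?; lin
  | |- GRing.linear_for _ ?f => refine (_ : islin f); lin
  | |- trilin _ => split=> ? ?; lin
  | |- forall _, _ => intro; lin
  | |- @islin ?k ?X ?Y ?f =>
    lazymatch f with
    | (fun x => x) => exact (@lin_id k X)
    | (fun x => @tens _ ?U ?V (@?g x) (@?v x)) =>
      lazymatch v with (fun _ => ?c) => refine (@lin_tensl k U V X g c _)
      | _ => lazymatch g with (fun _ => ?c) => refine (@lin_tensr k U V X v c _) end end; lin
    | (fun x => @lact _ _ _ (LRpre_of ?M) (@?g x) (@?v x)) =>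
      lazymatch v with (fun _ => ?c) => refine (@lin_lactl k _ _ X M g c _)
      | _ => lazymatch g with (fun _ => ?c) => refine (@lin_lactr k _ _ X M c v _) end end; lin
    | (fun x => @ract _ _ _ (LRpre_of ?M) (@?g x) (@?v x)) =>
      lazymatch v with (fun _ => ?c) => refine (@lin_ractl k _ _ X M g c _)
      | _ => lazymatch g with (fun _ => ?c) => refine (@lin_ractr k _ _ X M c v _) end end; lin
    | (fun x => @lcoact _ _ _ (LRpre_of ?M) (@?g x)) => refine (@lin_lcoact k _ _ X M g _); lin
    | (fun x => @rcoact _ _ _ (LRpre_of ?M) (@?g x)) => refine (@lin_rcoact k _ _ X M g _); lin
    | (fun x => @LRhom_fun _ _ _ ?M ?N ?f (@?g x)) => refine (@lin_hom k _ _ X M N f g _); lin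
    | (fun x => @hopf_aut_fun _ ?H ?f (@?g x)) => refine (@lin_aut k H X f g _); lin
    | (fun x => @hdelta _ ?H (@?g x)) => refine (@lin_delta k H X g _); lin
    | (fun x => @antipode _ ?H (@?g x)) => refine (@lin_antipode k H X g _); lin
    | (fun x => @GRing.scale _ _ (@?c x) (@?g x)) =>
      lazymatch c with
      | (fun _ => ?a) => refine (@lin_scaler k X Y g a _)
      | (fun y => @heps _ ?H (@?h y)) =>
        lazymatch g with (fun _ => ?v) => refine (@lin_eps k H X Y v h _) end
      | _ => lazymatch g with (fun _ => ?v) => refine (@lin_scalel k X Y c v _) end
      end; lin
    | (fun x => @GRing.mul ?R (@?g x) (@?c x)) =>
      let H := hopf_of R in
      lazymatch c with (fun _ => ?v) => refine (@lin_mull k H X g v _)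
      | _ => lazymatch g with (fun _ => ?v) => refine (@lin_mulr k H X c v _) end end; lin
    | (fun x => @tsum _ ?U ?V _ (@?F x) (@?g x)) =>
      lazymatch g with (fun _ => ?c) => refine (@lin_tsum_body k U V Y X F c _) => ? ?
      | _ => lazymatch F with
             (fun _ => ?c) => refine (@lin_tsum_src k U V Y X c g _ _) end end; lin
    | (fun x => ?F (@?a x) (@?b x) (@?c x)) =>
      first [solve [eauto] |
      lazymatch b with
      | (fun _ => ?b0) => lazymatch c with
        | (fun _ => ?c0) => refine (@lin_comp k X _ Y (fun y => F y b0 c0) a _ _)
        | _ => lazymatch a with (fun _ => ?a0) =>
          refine (@lin_comp k X _ Y (fun y => F a0 b0 y) c _ _) end end
      | _ => lazymatch a with (fun _ => ?a0) => lazymatch c with (fun _ => ?c0) =>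
          refine (@lin_comp k X _ Y (fun y => F a0 y c0) b _ _) end end
      end; [solve [eauto] | lin]]
    | (fun x => ?F (@?a x) (@?b x)) =>
      first [solve [eauto] |
      lazymatch b with
      | (fun _ => ?b0) => refine (@lin_comp k X _ Y (fun y => F y b0) a _ _)
      | _ => lazymatch a with (fun _ => ?a0) =>
          refine (@lin_comp k X _ Y (fun y => F a0 y) b _ _) end
      end; [solve [eauto] | lin]]
    | (fun x => ?F (@?a x)) =>
      first [solve [eauto] | refine (@lin_comp k X _ Y F a _ _); [solve [eauto] | lin]]
    | (fun _ => _) => idtac
    | ?f => first [assumption | solve [eauto] | change (@islin k X Y (fun x => f x)); lin ]
    end
  | |- _ => idtac
  end.

(* [hoist] proves [e = ?E] where [?E] is [e] with a subterm [tsum g x] moved outside *)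
Ltac hoist k U V e t g x :=
  let e' := eval pattern t in e in
  lazymatch e' with ?C _ => refine (@lin_tsum k U V _ _ C g x _); lin end.

Lemma islinZ (k : fieldType) (U V : lmodType k) (F : U -> V) a x :
  islin F -> F (a *: x) = a *: F x.
Proof.
move=> Fl; have F0 : F 0 = 0.
  by apply: (addIr (F 0)); have := Fl 1 0 0; rewrite !scale1r !add0r => <-.
by have := Fl a x 0; rewrite F0 !addr0.
Qed.

(** On [k^o] scaling is multiplication; this pulls a counit scalar out of a coefficient in the unit
    constraints. *)
Lemma scale_regA (k : fieldType) (V : lmodType k) (c : k) (a : k^o) (v : V) :
  (c *: a : k) *: v = c *: ((a : k) *: v).
Proof. by rewrite scalerA. Qed.

(** * Calculus of iterated sums *)

Section Expand.
Variables (k : fieldType) (H H1 H2 : hopfAlgType k) (M : LRobj H1 H2).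

Lemma deltaM (g h : H) : hdelta (g * h) =
  \tsum_(g1 ⊗ g2 <- hdelta g) \tsum_(h1 ⊗ h2 <- hdelta h) ((g1 * h1) ⊗ (g2 * h2)).
Proof. exact: hdeltaM. Qed.

Lemma delta1 : hdelta (1 : H) = 1 ⊗ 1.
Proof. exact: hdelta1. Qed.

Lemma delta_aut (f : hopfAut H) h :
  hdelta (f h) = \tsum_(h1 ⊗ h2 <- hdelta h) (f h1 ⊗ f h2).
Proof. exact: (ha_delta (hopf_autP f)). Qed.

Lemma lcoact_ract (m : M) (h : H2) :
  lcoact (m ◁ h) = \tsum_(a ⊗ m0 <- lcoact m) (a ⊗ m0 ◁ h).
Proof. exact: (LR_right_left (LRobjP M)). Qed.

Lemma rcoact_lact (h : H1) (m : M) :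
  rcoact (h ▷ m) = \tsum_(m0 ⊗ b <- rcoact m) (h ▷ m0 ⊗ b).
Proof. exact: (LR_left_right (LRobjP M)). Qed.

Lemma lcoact_hom (N : LRobj H1 H2) (f : LRhom M N) m :
  lcoact (f m) = \tsum_(a ⊗ m0 <- lcoact m) (a ⊗ f m0).
Proof. exact: (LRhom_lcoact (LRhomP f)). Qed.

Lemma rcoact_hom (N : LRobj H1 H2) (f : LRhom M N) m :
  rcoact (f m) = \tsum_(m0 ⊗ b <- rcoact m) (f m0 ⊗ b).
Proof. exact: (LRhom_rcoact (LRhomP f)). Qed.

End Expand.

(** There is no case for [lcoact (h ▷ m)] or [rcoact (m ◁ h)]: the Yetter-Drinfeld conditions equate
    two sums and do not express such a coaction by simpler ones, so they are applied by hand. *)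
Ltac expand y :=
  lazymatch y with
  | @hdelta _ ?H (@GRing.mul _ ?g ?h) => constr:(@deltaM _ H g h)
  | @hdelta _ ?H (@hopf_aut_fun _ _ ?f ?h) => constr:(@delta_aut _ H f h)
  | @hdelta _ ?H (@GRing.one _) => constr:(@delta1 _ H)
  | @lcoact _ _ _ (LRpre_of ?M) (@ract _ _ _ _ ?m ?h) => constr:(@lcoact_ract _ _ _ M m h)
  | @rcoact _ _ _ (LRpre_of ?M) (@lact _ _ _ _ ?h ?m) => constr:(@rcoact_lact _ _ _ M h m)
  | @lcoact _ _ _ _ (@LRhom_fun _ _ _ ?M ?N ?f ?m) => constr:(@lcoact_hom _ _ _ M N f m)
  | @rcoact _ _ _ _ (@LRhom_fun _ _ _ ?M ?N ?f ?m) => constr:(@rcoact_hom _ _ _ M N f m)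
  end.

(* [nf] proves [e = ?E] where [?E] is [e] with all sums moved outside, and taken over
   comultiplications and coactions that cannot be expanded further *)
Ltac nf :=
  cbv beta;
  lazymatch goal with
  | |- @tsum ?k ?U ?V ?W ?f ?y = _ =>
    lazymatch y with
    | ?u ⊗ ?v => etransitivity; [refine (@tsum_tens k U V _ f u v _); lin | nf]
    | context [@tsum ?k' ?U' ?V' ?W' ?g ?x] =>
      etransitivity;
      [ let t := constr:(@tsum k' U' V' W' g x) in
        let e := constr:(@tsum k U V W f y) in hoist k' U' V' e t g x
      | nf ]
    | _ => first [let E := expand y in etransitivity; [refine (congr1 (tsum f) E) | nf]
           | refine (@eq_tsum_ptwise k U V W _ _ y _); intros; nf]
    end
  | |- ?e = _ =>
    lazymatch e with
    | context [@tsum ?k' ?U' ?V' ?W' ?g ?x] =>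
      etransitivity;
      [ let t := constr:(@tsum k' U' V' W' g x) in hoist k' U' V' e t g x | nf ]
    | _ =>
      first [let E := expand e in etransitivity; [exact E | nf]
      | match e with context [?y] =>
          let E := expand y in etransitivity; [
          let e' := eval pattern y in e in
          lazymatch e' with ?C _ => refine (congr1 C E) end | nf ]
          end
      | reflexivity ]
    end
  end.

Ltac nfl := etransitivity; [solve [nf] | ]; cbv beta.
Ltac nfr := symmetry; nfl; symmetry.

(** The two sides of the goal are the normal forms of the two sides of the law [E]. *)
Ltac by_law E := refine (etrans (esym _) (etrans E _)); nf.

(* [bring x] proves [e = ?E] where the sum over [x] inside [e] is made outermost *)
Ltac bring x :=
  lazymatch goal with
  | |- tsum _ ?y = _ => first
    [ unify x y; reflexivity
    | etransitivity; [refine (eq_tsum_ptwise y _); intros; cbv beta; bring x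
                     | exact (exchange_tsum _ _ _)] ]
  end.

(* [tm] reduces an equality of iterated sums to one of summands, looking up each sum
   of the left-hand side on the right-hand side *)
Ltac tm :=
  cbv beta;
  lazymatch goal with
  | |- tsum _ ?x = _ =>
    refine (etrans _ (esym _)); [| bring x];
    refine (eq_tsum_ptwise x _); intros; tm
  | |- _ => idtac
  end.

(** * The axioms of Hopf algebras and objects under a multilinear function *)

Section HopfSums.
Variables (k : fieldType) (H : hopfAlgType k) (W : lmodType k).
Implicit Types (g h : H).

Lemma tsum_coassoc (F : H -> H -> H -> W) h : trilin F ->
  \tsum_(x ⊗ h3 <- hdelta h) \tsum_(h1 ⊗ h2 <- hdelta x) F h1 h2 h3
  = \tsum_(h1 ⊗ x <- hdelta h) \tsum_(h2 ⊗ h3 <- hdelta x) F h1 h2 h3.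
Proof.
case=> F1 F2 F3.
(* The law holds in [H ⊗ (H ⊗ H)]; the function applied to it sums [F] over the inner tensor. *)
by_law (congr1 (tsum (fun h1 y => \tsum_(h2 ⊗ h3 <- y) F h1 h2 h3)) (hdelta_coassoc h)).
Qed.

Lemma tsum_counitl (F : H -> W) h : islin F ->
  \tsum_(h1 ⊗ h2 <- hdelta h) (heps h1 *: F h2) = F h.
Proof.
move=> Fl; rewrite -[in RHS](hdelta_counitl h) lin_tsum //.
by apply: eq_tsum_ptwise => u v; rewrite islinZ.
Qed.

Lemma tsum_counitr (F : H -> W) h : islin F ->
  \tsum_(h1 ⊗ h2 <- hdelta h) (heps h2 *: F h1) = F h.
Proof.
move=> Fl; rewrite -[in RHS](hdelta_counitr h) lin_tsum //.
by apply: eq_tsum_ptwise => u v; rewrite islinZ.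
Qed.

Lemma tsum_antipodel (F : H -> W) h : islin F ->
  \tsum_(h1 ⊗ h2 <- hdelta h) F (antipode h1 * h2) = heps h *: F 1.
Proof. by move=> Fl; rewrite -islinZ // -(antipodel h) lin_tsum. Qed.

Lemma tsum_antipoder (F : H -> W) h : islin F ->
  \tsum_(h1 ⊗ h2 <- hdelta h) F (h1 * antipode h2) = heps h *: F 1.
Proof. by move=> Fl; rewrite -islinZ // -(antipoder h) lin_tsum. Qed.

End HopfSums.

Section LRSums.
Variables (k : fieldType) (H1 H2 : hopfAlgType k) (M : LRobj H1 H2) (W : lmodType k).
Implicit Types (m : M).

Lemma tsum_lcounit (F : M -> W) m : islin F ->
  \tsum_(a ⊗ m0 <- lcoact m) (heps a *: F m0) = F m.
Proof.
move=> Fl; rewrite -[in RHS](lcoact_counit (LRobjP M) m) lin_tsum //.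
by apply: eq_tsum_ptwise => u v; rewrite islinZ.
Qed.

Lemma tsum_rcounit (F : M -> W) m : islin F ->
  \tsum_(m0 ⊗ b <- rcoact m) (heps b *: F m0) = F m.
Proof.
move=> Fl; rewrite -[in RHS](rcoact_counit (LRobjP M) m) lin_tsum //.
by apply: eq_tsum_ptwise => u v; rewrite islinZ.
Qed.

Lemma tsum_lcoassoc (F : H1 -> H1 -> M -> W) m : trilin F ->
  \tsum_(a ⊗ m0 <- lcoact m) \tsum_(a1 ⊗ a2 <- hdelta a) F a1 a2 m0
  = \tsum_(a1 ⊗ x <- lcoact m) \tsum_(a2 ⊗ m0 <- lcoact x) F a1 a2 m0.
Proof.
case=> F1 F2 F3.
by_law (congr1 (tsum (fun h1 y => \tsum_(h2 ⊗ h3 <- y) F h1 h2 h3))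
  (lcoact_coassoc (LRobjP M) m)).
Qed.

Lemma tsum_rcoassoc (F : M -> H2 -> H2 -> W) m : trilin F ->
  \tsum_(m0 ⊗ b <- rcoact m) \tsum_(b1 ⊗ b2 <- hdelta b) F m0 b1 b2
  = \tsum_(x ⊗ b2 <- rcoact m) \tsum_(m0 ⊗ b1 <- rcoact x) F m0 b1 b2.
Proof.
case=> F1 F2 F3.
by_law (congr1 (tsum (fun y b2 => \tsum_(m0 ⊗ b1 <- y) F m0 b1 b2))
  (rcoact_coassoc (LRobjP M) m)).
Qed.

Lemma tsum_lrcoact (F : H1 -> M -> H2 -> W) m : trilin F ->
  \tsum_(a ⊗ x <- lcoact m) \tsum_(m0 ⊗ b <- rcoact x) F a m0 b
  = \tsum_(x ⊗ b <- rcoact m) \tsum_(a ⊗ m0 <- lcoact x) F a m0 b.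
Proof.
case=> F1 F2 F3.
by_law (congr1 (tsum (fun a y => \tsum_(m0 ⊗ b <- y) F a m0 b))
  (lrcoact (LRobjP M) m)).
Qed.

(** The left Yetter-Drinfeld condition twisted by [lrα] and [lrβ]. Read from left to right, it moves
    the action of [h] inside the coaction. *)
Lemma tsum_LR_left (F : H1 -> M -> W) h m : bilin F ->
  \tsum_(h1 ⊗ h2 <- hdelta h) \tsum_(a ⊗ m0 <- lcoact m)
    F (lrα (LRdeg M) h1 * a) (h2 ▷ m0)
  = \tsum_(h1 ⊗ h2 <- hdelta h) \tsum_(a ⊗ m0 <- lcoact (h1 ▷ m))
      F (a * lrβ (LRdeg M) h2) m0.
Proof.
(* The halves of [bilin] become separate hypotheses because [lin] looks for facts of the form
   [islin]. *)
move=> Fb; have [F1 F2] : (forall m, islin (fun h => F h m))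
  /\ (forall h, islin (fun m => F h m)) by [].
by_law (congr1 (tsum F) (LR_left (LRobjP M) h m)).
Qed.

Lemma tsum_LR_right (F : M -> H2 -> W) h m : bilin F ->
  \tsum_(h1 ⊗ h2 <- hdelta h) \tsum_(m0 ⊗ b <- rcoact m)
    F (m0 ◁ h1) (b * lrδ (LRdeg M) h2)
  = \tsum_(h1 ⊗ h2 <- hdelta h) \tsum_(m0 ⊗ b <- rcoact (m ◁ h2))
      F m0 (lrγ (LRdeg M) h1 * b).
Proof.
move=> Fb; have [F1 F2] : (forall h, islin (fun m => F m h))
  /\ (forall m, islin (fun h => F m h)) by [].
by_law (congr1 (tsum F) (LR_right (LRobjP M) h m)).
Qed.

End LRSums.

(** * Computation with automorphisms and with the components of elements of the group *)

Section GroupRules.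
Variables (k : fieldType) (H H1 H2 : hopfAlgType k).
Implicit Types (x y : LRgroup H1 H2) (f g : hopfAut H) (a b : H).
Local Open Scope group_scope.

Lemma lrαM x y : lrα (x * y) = lrα y * lrα x.
Proof. by case: x; case: y. Qed.
Lemma lrβM x y : lrβ (x * y) = lrα y * lrβ x * (lrα y)^-1 * lrβ y.
Proof. by case: x; case: y. Qed.
Lemma lrγM x y : lrγ (x * y) = lrγ x * lrγ y.
Proof. by case: x; case: y. Qed.
Lemma lrδM x y : lrδ (x * y) = lrδ y * (lrγ y)^-1 * lrδ x * lrγ y.
Proof. by case: x; case: y. Qed.
Lemma lrαV x : lrα x^-1 = (lrα x)^-1.
Proof. by case: x. Qed.
Lemma lrβV x : lrβ x^-1 = (lrα x)^-1 * (lrβ x)^-1 * lrα x.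
Proof. by case: x. Qed.
Lemma lrγV x : lrγ x^-1 = (lrγ x)^-1.
Proof. by case: x. Qed.
Lemma lrδV x : lrδ x^-1 = lrγ x * (lrδ x)^-1 * (lrγ x)^-1.
Proof. by case: x. Qed.

Lemma lrα1 : lrα (1 : LRgroup H1 H2) = 1.
Proof. by []. Qed.
Lemma lrβ1 : lrβ (1 : LRgroup H1 H2) = 1.
Proof. by []. Qed.
Lemma lrγ1 : lrγ (1 : LRgroup H1 H2) = 1.
Proof. by []. Qed.
Lemma lrδ1 : lrδ (1 : LRgroup H1 H2) = 1.
Proof. by []. Qed.

Definition degE := (lrα1, lrβ1, lrγ1, lrδ1, lrαM, lrβM, lrγM, lrδM,
  lrαV, lrβV, lrγV, lrδV).

Lemma autM f g a : (f * g) a = f (g a).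
Proof. by []. Qed.
Lemma aut1 a : (1 : hopfAut H) a = a.
Proof. by []. Qed.
Lemma autK f a : f^-1 (f a) = a.
Proof. exact: hopf_autK. Qed.
Lemma autVK f a : f (f^-1 a) = a.
Proof. exact: hopf_autVK. Qed.
Lemma aut_mul f a b : f (a * b)%R = (f a * f b)%R.
Proof. exact: (ha_M (hopf_autP f)). Qed.
Lemma aut_one f : f 1%R = 1%R.
Proof. exact: (ha_1 (hopf_autP f)). Qed.
Lemma aut_eps f a : heps (f a) = heps a.
Proof. exact: (ha_eps (hopf_autP f)). Qed.
Lemma eps_mul a b : heps (a * b)%R = (heps a * heps b)%R.
Proof. exact: hepsM. Qed.
Lemma eps_one : heps (1%R : H) = 1%R.
Proof. exact: heps1. Qed.

Lemma autV1 a : (1^-1 : hopfAut H) a = a.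
Proof. by rewrite invg1. Qed.

(** Turns words of automorphisms into successive applications, cancels inverse pairs and distributes
    over products. Together with [degE] it compares the twists of two structures by computation. *)
Definition autE := (autV1, @invgM (hopfAut H), @invgK (hopfAut H),
  autM, aut1, autK, autVK, aut_mul, aut_one).
End GroupRules.

Section ActRules.
Variables (k : fieldType) (H1 H2 : hopfAlgType k) (M : LRobj H1 H2).
Lemma act1l (m : M) : 1 ▷ m = m.
Proof. exact: (lact1 (LRobjP M)). Qed.
Lemma act1r (m : M) : m ◁ 1 = m.
Proof. exact: (ract1 (LRobjP M)). Qed.
Lemma actMl g h (m : M) : (g * h) ▷ m = g ▷ (h ▷ m).
Proof. exact: (lactM (LRobjP M)). Qed.
Lemma actMr g h (m : M) : m ◁ (g * h) = (m ◁ g) ◁ h.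
Proof. exact: (ractM (LRobjP M)). Qed.
Lemma actC g h (m : M) : (g ▷ m) ◁ h = g ▷ (m ◁ h).
Proof. exact: (lract (LRobjP M)). Qed.
End ActRules.

(* [under_sums n tac] rewrites the left-hand side under its [n] outermost sums *)
Tactic Notation "under_sums" integer(n) tactic3(tac) :=
  etransitivity;
  [ do n (refine (eq_tsum_ptwise _ _); intros; cbv beta); tac | cbv beta ].

Ltac unf := cbn [lact ract lcoact rcoact LRspace LRdeg LRtens LRconj LRunit].

Ltac by_pure x := lazymatch goal with |- ?A = ?B =>
  let f := (eval pattern x in A) in let g := (eval pattern x in B) in
  lazymatch f with ?f0 _ => lazymatch g with ?g0 _ =>
  refine (tens_ext (f:=f0) (g:=g0) _ _ _ x); [lin|lin| cbv beta] end end end.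

(** * Objects and morphisms *)

Section Tens.
Variables (k : fieldType) (H1 H2 : hopfAlgType k) (M N : LRobj H1 H2).
Local Notation α1 := (lrα (LRdeg M)).
Local Notation β1 := (lrβ (LRdeg M)).
Local Notation δ1 := (lrδ (LRdeg M)).
Local Notation α2 := (lrα (LRdeg N)).
Local Notation γ2 := (lrγ (LRdeg N)).
Local Notation δ2 := (lrδ (LRdeg N)).

(** The substantial conditions are the two compatibilities. The left one uses that of [M], then that
    of [N]; the right one uses that of [N], then that of [M]; coassociativity regroups the legs of
    [h] in between. *)
Lemma LRtensP : is_LR (LRtens M N).
Proof.
split; unf.
- apply: bilinI; lin.
- move=> x; by_pure x => m n; nfl; by rewrite !act1l.
- move=> g h x; by_pure x => m n; nfl; nfr; tm; by rewrite !actMl.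
- apply: bilinI; lin.
- move=> x; by_pure x => m n; nfl; by rewrite !aut_one !act1r.
- move=> g h x; by_pure x => m n; nfl; nfr; tm; by rewrite !aut_mul !actMr.
- move=> g x h; by_pure x => m n; nfl; nfr; tm; by rewrite !actC.
- lin.
- move=> x; by_pure x => m n; nfl.
  (* The counit is multiplicative and invariant under automorphisms, so the sum over [lcoact n]
     collapses first, then the one over [lcoact m]. *)
  under_sums 1 (under_sums 1 (rewrite eps_mul !aut_eps mulrC -scalerA; reflexivity);
    refine (tsum_lcounit _ _); lin).
  by refine (tsum_lcounit _ _); lin.
- move=> x; by_pure x => m n; nfl; nfr.
  (* The comultiplication of [a] must stand directly under the coaction that produces [a] before
     coassociativity applies, first to [m] and then to [n]. *)
  etransitivity; [refine (eq_tsum_ptwise _ _) => a m0; bring (hdelta a)|].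
  rewrite tsum_lcoassoc; last lin.
  under_sums 2 (refine (tsum_lcoassoc _ _); lin).
  tm; by rewrite ?aut_mul.
- lin.
- move=> x; by_pure x => m n; nfl.
  under_sums 1 (under_sums 1 (rewrite eps_mul mulrC -scalerA; reflexivity);
    refine (tsum_rcounit _ _); lin).
  by refine (tsum_rcounit _ _); lin.
- move=> x; by_pure x => m n; nfl; nfr.
  etransitivity; [refine (eq_tsum_ptwise _ _) => m0 a; bring (hdelta a)|].
  rewrite tsum_rcoassoc; last lin.
  under_sums 2 (refine (tsum_rcoassoc _ _); lin).
  by tm.
- move=> x; by_pure x => m n; nfl; nfr.
  etransitivity; [refine (eq_tsum_ptwise _ _) => a m0; bring (rcoact m0)|].
  rewrite tsum_lrcoact; last lin.
  under_sums 2 (refine (tsum_lrcoact _ _); lin).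
  by tm.
- move=> h x; by_pure x => m n; nfl; nfr; rewrite !degE.
  transitivity (\tsum_(u ⊗ v <- hdelta h) \tsum_(p ⊗ q <- hdelta v)
    \tsum_(a ⊗ m0 <- lcoact m) \tsum_(b ⊗ n0 <- lcoact n)
     (α2 (α1 u * a) * α2 (β1 (α2^-1%g b)) ⊗
      (p ▷ m0 ⊗ q ▷ n0))).
    tm; by rewrite !autE mulrA.
  rewrite -(tsum_coassoc (F := fun u p q =>
    \tsum_(a ⊗ m0 <- lcoact m) \tsum_(b ⊗ n0 <- lcoact n)
     (α2 (α1 u * a) * α2 (β1 (α2^-1%g b)) ⊗
      (p ▷ m0 ⊗ q ▷ n0)))); last lin.
  under_sums 1 (refine (tsum_LR_left (F := fun A B => \tsum_(b ⊗ n0 <- lcoact n)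
     (α2 A * α2 (β1 (α2^-1%g b)) ⊗
      (B ⊗ _ ▷ n0))) _ _ _); lin).
  rewrite tsum_coassoc; last lin.
  (* The factor [β1 p] left by the condition for [M] is written through [α2 p], the form in which
     the condition for [N] takes it. *)
  transitivity (\tsum_(u ⊗ v <- hdelta h) \tsum_(a ⊗ m0 <- lcoact (u ▷ m))
    \tsum_(p ⊗ q <- hdelta v) \tsum_(b ⊗ n0 <- lcoact n)
     (α2 a * α2 (β1 (α2^-1%g (α2 p * b))) ⊗
      (m0 ⊗ q ▷ n0))).
    tm; by rewrite !autE mulrA.
  under_sums 2 (refine (tsum_LR_left (F := fun A B =>
     (α2 _ * α2 (β1 (α2^-1%g A)) ⊗
      (_ ⊗ B))) _ _ _); lin).
  rewrite tsum_coassoc; last lin.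
  tm; by rewrite !autE mulrA.
- move=> h x; by_pure x => m n; nfl; nfr; by tm.
- move=> h x; by_pure x => m n; nfl; nfr; rewrite !degE.
  transitivity (\tsum_(u ⊗ v <- hdelta h) \tsum_(p ⊗ q <- hdelta u)
    \tsum_(m0 ⊗ a <- rcoact m) \tsum_(n0 ⊗ b <- rcoact n)
     ((m0 ◁ γ2 p
       ⊗ n0 ◁ (γ2^-1%g (δ1 (γ2 q))))
      ⊗ (a * (b * δ2 (γ2^-1%g (δ1 (γ2 v))))))).
    tm; by rewrite !autE mulrA.
  rewrite tsum_coassoc; last lin.
  (* With [γ2^-1 * δ1 * γ2] moved inside [hdelta] this is an instance of the condition for [N]; it
     yields [δ1 (γ2 q)], which the condition for [M] at [γ2 x] consumes. *)
  transitivity (\tsum_(p ⊗ y <- hdelta h) \tsum_(m0 ⊗ a <- rcoact m)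
    \tsum_(q ⊗ v <- hdelta (γ2^-1%g (δ1 (γ2 y))))
    \tsum_(n0 ⊗ b <- rcoact n)
     ((m0 ◁ γ2 p ⊗ n0 ◁ q) ⊗ (a * (b * δ2 v)))).
    nfr; by tm.
  under_sums 2 (refine (tsum_LR_right
    (F := fun A B => ((_ ◁ γ2 _ ⊗ A) ⊗ (_ * B))) _ _ _); lin).
  transitivity (\tsum_(p ⊗ y <- hdelta h) \tsum_(q ⊗ v <- hdelta y)
    \tsum_(m0 ⊗ a <- rcoact m) \tsum_(n0 ⊗ b <- rcoact (n ◁ (γ2^-1%g (δ1 (γ2 v)))))
     ((m0 ◁ γ2 p ⊗ n0) ⊗ (a * δ1 (γ2 q) * b))).
    nfl; tm; by rewrite !autE mulrA.
  rewrite -(tsum_coassoc (F := fun p q v => \tsum_(m0 ⊗ a <- rcoact m)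
    \tsum_(n0 ⊗ b <- rcoact (n ◁ (γ2^-1%g (δ1 (γ2 v)))))
     ((m0 ◁ γ2 p ⊗ n0) ⊗ (a * δ1 (γ2 q) * b)))); last lin.
  transitivity (\tsum_(x ⊗ v <- hdelta h) \tsum_(p ⊗ q <- hdelta (γ2 x))
    \tsum_(m0 ⊗ a <- rcoact m)
    \tsum_(n0 ⊗ b <- rcoact (n ◁ (γ2^-1%g (δ1 (γ2 v)))))
     ((m0 ◁ p ⊗ n0) ⊗ (a * δ1 q * b))).
    nfr; by tm.
  under_sums 1 (refine (tsum_LR_right (F := fun A B =>
    \tsum_(n0 ⊗ b <- rcoact (n ◁ (γ2^-1%g (δ1 (γ2 _)))))
     ((A ⊗ n0) ⊗ (B * b))) _ _ _); lin).
  nfl.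
  rewrite tsum_coassoc; last lin.
  tm; by rewrite !autE mulrA.
- move=> h x; by_pure x => m n; nfl; nfr; by tm.
Qed.
End Tens.

(** * The unit object and conjugate objects *)

Section Conj.
Variables (k : fieldType) (H1 H2 : hopfAlgType k) (x : LRgroup H1 H2) (N : LRobj H1 H2).
Local Notation α1 := (lrα x).
Local Notation β1 := (lrβ x).
Local Notation γ1 := (lrγ x).
Local Notation δ1 := (lrδ x).
Local Notation α2 := (lrα (LRdeg N)).
Local Notation γ2 := (lrγ (LRdeg N)).
Local Notation δ2 := (lrδ (LRdeg N)).

(** In both compatibilities the counit laws reduce either side to the same pure tensor of [h] and
    [m]. *)
Lemma LRunitP : is_LR (LRunit H1 H2).
Proof.
split; unf.
- apply: bilinI; lin.
- by move=> m; rewrite eps_one scale1r.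
- by move=> g h m; rewrite eps_mul scalerA.
- apply: bilinI; lin.
- by move=> m; rewrite eps_one scale1r.
- by move=> g h m; rewrite eps_mul scalerA mulrC.
- by move=> g m h; rewrite !scalerA mulrC.
- lin.
- by move=> m; nfl; rewrite eps_one scale1r.
- by move=> m; nfl; nfr.
- lin.
- by move=> m; nfl; rewrite eps_one scale1r.
- by move=> m; nfl; nfr.
- by move=> m; nfl; nfr.
- move=> h m; nfl; nfr.
  under_sums 1 (rewrite mulr1 islinZ; [reflexivity | lin]).
  rewrite tsum_counitr; last lin.
  symmetry; under_sums 1 (rewrite mul1r islinZ; [reflexivity | lin]).
  by rewrite tsum_counitl; last lin.
- by move=> h m; nfl; nfr.
- move=> h m; nfl; nfr.
  under_sums 1 (rewrite mul1r (islinZ (F := fun y => y ⊗ _)); [reflexivity | lin]).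
  rewrite tsum_counitl; last lin.
  symmetry.
  under_sums 1 (rewrite mulr1 (islinZ (F := fun y => y ⊗ _)); [reflexivity | lin]).
  by rewrite tsum_counitr; last lin.
- by move=> h m; nfl; nfr.
Qed.

(** The left condition at [h] is that of [N] at [(β1^-1 * α1) h], with [α1^-1 * α2 * β1 * α2^-1]
    applied to the leg in [H1]. The right one is that of [N] at [(γ2^-1 * δ1 * γ2 * γ1^-1) h], with
    [γ1 * δ1^-1] applied to the leg in [H2]. *)
Lemma LRconjP : is_LR (LRconj x N).
Proof.
split; unf.
- apply: bilinI; lin.
- by move=> m; rewrite aut_one act1l.
- by move=> g h m; rewrite aut_mul actMl.
- apply: bilinI; lin.
- by move=> m; rewrite aut_one act1r.
- by move=> g h m; rewrite aut_mul actMr.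
- by move=> g m h; rewrite actC.
- lin.
- move=> m; nfl.
  under_sums 1 (rewrite aut_eps; reflexivity).
  by refine (tsum_lcounit _ _); lin.
- move=> m; nfl; nfr. rewrite tsum_lcoassoc; last lin. by tm.
- lin.
- move=> m; nfl.
  under_sums 1 (rewrite aut_eps; reflexivity).
  by refine (tsum_rcounit _ _); lin.
- move=> m; nfl; nfr. rewrite tsum_rcoassoc; last lin. by tm.
- move=> m; nfl; nfr. rewrite tsum_lrcoact; last lin. by tm.
- move=> h n. rewrite !degE. nfl. nfr.
  transitivity (\tsum_(h1 ⊗ h2 <- hdelta ((β1^-1 * α1)%g h)) \tsum_(a ⊗ n0 <- lcoact n)
    ((α1^-1 * α2 * β1 * α2^-1)%g (α2 h1 * a) ⊗ h2 ▷ n0)).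
    nfr; tm; by rewrite !autE.
  etransitivity; [refine (tsum_LR_left (F := fun A B =>
    ((α1^-1 * α2 * β1 * α2^-1)%g A ⊗ B)) _ _ _); lin|].
  nfl; tm; by rewrite !autE.
- by move=> h n; nfl; nfr.
- move=> h n. rewrite !degE. nfl. nfr.
  transitivity (\tsum_(h1 ⊗ h2 <- hdelta ((γ2^-1 * δ1 * γ2 * γ1^-1)%g h))
    \tsum_(n0 ⊗ a <- rcoact n)
    (n0 ◁ h1 ⊗ (γ1 * δ1^-1)%g (a * δ2 h2))).
    nfr; tm; by rewrite !autE.
  etransitivity; [refine (tsum_LR_right (F := fun A B =>
    (A ⊗ (γ1 * δ1^-1)%g B)) _ _ _); lin|].
  nfl; tm; by rewrite !autE.
- by move=> h n; nfl; nfr.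
Qed.
End Conj.

(** * Tensor products and conjugates of morphisms, and the monoidal constraints *)

Section Homs.
Variables (k : fieldType) (H1 H2 : hopfAlgType k).
Implicit Types M N P : LRobj H1 H2.

Lemma LRtensmP M M' N N' (f : LRhom M M') (g : LRhom N N') :
  @is_LRhom k H1 H2 (LRtens M N) (LRtens M' N') (tmap f g).
Proof.
have fL := LRhom_lact (LRhomP f); have gL := LRhom_lact (LRhomP g).
have fR := LRhom_ract (LRhomP f); have gR := LRhom_ract (LRhomP g).
(* The structure maps depend on the indices, which morphisms preserve. *)
split; unf; rewrite -?(LRhom_deg (LRhomP f)) -?(LRhom_deg (LRhomP g)) // /tmap.
- lin.
- move=> h x; by_pure x => m n; nfl; nfr; tm; by rewrite fL gL.
- move=> x h; by_pure x => m n; nfl; nfr; tm; by rewrite fR gR.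
- move=> x; by_pure x => m n; nfl; nfr; by tm.
- move=> x; by_pure x => m n; nfl; nfr; by tm.
Qed.

Lemma LRconjmP (x : LRgroup H1 H2) N N' (f : LRhom N N') :
  @is_LRhom k H1 H2 (LRconj x N) (LRconj x N') f.
Proof.
split; unf; rewrite -?(LRhom_deg (LRhomP f)) //.
- lin.
- by move=> h m; rewrite (LRhom_lact (LRhomP f)).
- by move=> h m; rewrite (LRhom_ract (LRhomP f)).
- by move=> m; nfl; nfr; tm.
- by move=> m; nfl; nfr; tm.
Qed.


(** Compatibility with the actions is coassociativity of the comultiplication, and with the
    coactions associativity of the product; the twists agree by the group law. *)
Lemma LRassocP M N P :
    @is_LRhom k H1 H2 (LRtens (LRtens M N) P) (LRtens M (LRtens N P)) (@tassoc k M N P).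
Proof.
split; unf; rewrite ?mulgA // /tassoc.
- lin.
- move=> h x; by_pure x => y p; by_pure y => m n; nfl; nfr.
  rewrite tsum_coassoc; last lin. by tm.
- move=> x h; by_pure x => y p; by_pure y => m n; nfl; nfr.
  rewrite tsum_coassoc; last lin. tm; by rewrite !degE !autE.
- move=> x; by_pure x => y p; by_pure y => m n; nfl; nfr.
  tm; by rewrite !degE !autE mulrA.
- move=> x; by_pure x => y p; by_pure y => m n; nfl; nfr.
  tm; by rewrite mulrA.
Qed.

Lemma LRassocVP M N P :
    @is_LRhom k H1 H2 (LRtens M (LRtens N P)) (LRtens (LRtens M N) P) (@tassocV k M N P).
Proof.
split; unf; rewrite ?mulgA // /tassocV.
- lin.
- move=> h x; by_pure x => m y; by_pure y => n p; nfl; nfr.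
  rewrite tsum_coassoc; last lin. by tm.
- move=> x h; by_pure x => m y; by_pure y => n p; nfl; nfr.
  rewrite tsum_coassoc; last lin. tm; by rewrite !degE !autE.
- move=> x; by_pure x => m y; by_pure y => n p; nfl; nfr.
  tm; by rewrite !degE !autE mulrA.
- move=> x; by_pure x => m y; by_pure y => n p; nfl; nfr.
  tm; by rewrite mulrA.
Qed.

Lemma LRlunitP M : is_LRhom (@LRlunit k H1 H2 M).
Proof.
rewrite /LRlunit.
split; unf; rewrite ?mul1g //.
- lin.
- move=> h x; by_pure x => a m; nfl; nfr; rewrite islinZ; last lin.
  under_sums 1 (rewrite scale_regA; reflexivity).
  by refine (tsum_counitl _ _); lin.
- move=> x h; by_pure x => a m; nfl; nfr.
  rewrite (islinZ (F := fun y => y ◁ h)); last lin.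
  under_sums 1 (rewrite scale_regA !degE !autE aut_eps; reflexivity).
  by refine (tsum_counitl _ _); lin.
- move=> x; by_pure x => a m; nfl; nfr; rewrite islinZ; last lin.
  (* The coaction is written as a sum of pure tensors, so that both sides are sums over
     [lcoact m]. *)
  rewrite -[in LHS](tsum_id (lcoact m)) lin_tsum; last lin.
  tm; rewrite !degE !autE mul1r islinZ //; lin.
- move=> x; by_pure x => a m; nfl; nfr; rewrite islinZ; last lin.
  rewrite -[in LHS](tsum_id (rcoact m)) lin_tsum; last lin.
  tm; rewrite mul1r (islinZ (F := fun y => y ⊗ _)) //; lin.
Qed.

Lemma LRrunitP M : is_LRhom (@LRrunit k H1 H2 M).
Proof.
rewrite /LRrunit.
split; unf; rewrite ?mulg1 //.
- lin.
- move=> h x; by_pure x => m a; nfl; nfr; rewrite islinZ; last lin.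
  under_sums 1 (rewrite scale_regA; reflexivity).
  by refine (tsum_counitr _ _); lin.
- move=> x h; by_pure x => m a; nfl; nfr.
  rewrite (islinZ (F := fun y => y ◁ h)); last lin.
  under_sums 1 (rewrite scale_regA !degE !autE aut_eps; reflexivity).
  by refine (tsum_counitr _ _); lin.
- move=> x; by_pure x => m a; nfl; nfr; rewrite islinZ; last lin.
  rewrite -[in LHS](tsum_id (lcoact m)) lin_tsum; last lin.
  tm; rewrite !degE !autE mulr1 islinZ //; lin.
- move=> x; by_pure x => m a; nfl; nfr; rewrite islinZ; last lin.
  rewrite -[in LHS](tsum_id (rcoact m)) lin_tsum; last lin.
  tm; rewrite mulr1 (islinZ (F := fun y => y ⊗ _)) //; lin.
Qed.

End Homs.

(** * The braiding as a morphism *)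

Section Braid.
Variables (k : fieldType) (H1 H2 : hopfAlgType k) (M N : LRobj H1 H2).
Local Notation β1 := (lrβ (LRdeg M)).
Local Notation γ1 := (lrγ (LRdeg M)).
Local Notation δ1 := (lrδ (LRdeg M)).
Local Notation α2 := (lrα (LRdeg N)).
Local Notation β2 := (lrβ (LRdeg N)).
Local Notation γ2 := (lrγ (LRdeg N)).

(** Each property uses one Yetter-Drinfeld condition: the left one of [M] and the right one of [N]
    for the actions, the left one of [N] and the right one of [M] for the coactions. *)
Lemma LRbraidP : is_LRhom (@LRbraid k H1 H2 M N).
Proof.
rewrite /LRbraid.
split; unf; rewrite ?mulgVK //.
- lin.
- move=> h x; by_pure x => m n; nfl; nfr.
  transitivity (\tsum_(u ⊗ v <- hdelta h) \tsum_(a ⊗ m0 <- lcoact (u ▷ m))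
    \tsum_(n0 ⊗ b <- rcoact n)
    ((β1^-1%g (a * β1 v)) ▷ n0
     ⊗ m0 ◁ δ1^-1%g b)).
    tm; by rewrite !autE actMl.
  etransitivity; [symmetry; refine (tsum_LR_left (F := fun A B =>
    \tsum_(n0 ⊗ b <- rcoact n)
    (β1^-1%g A ▷ n0 ⊗ B ◁ δ1^-1%g b)) _ _ _); lin|].
  tm; by rewrite !autE actMl actC.
- move=> x h; by_pure x => m n; nfl; nfr.
  transitivity (\tsum_(u ⊗ v <- hdelta
      ((γ2^-1 * δ1 * γ2)%g h))
    \tsum_(n0 ⊗ b <- rcoact (n ◁ v)) \tsum_(a ⊗ m0 <- lcoact m)
    (β1^-1%g a ▷ n0
     ⊗ m0 ◁ (δ1^-1%g (γ2 u * b)))).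
    nfr; tm; by rewrite !autE actMr.
  etransitivity; [symmetry; refine (tsum_LR_right (F := fun A B =>
    \tsum_(a ⊗ m0 <- lcoact m)
    (β1^-1%g a ▷ A ⊗ m0 ◁ δ1^-1%g B)) _ _ _); lin|].
  nfl; tm; by rewrite !degE !autE actMr actC.
- move=> x; by_pure x => m n; nfl; nfr; rewrite !degE.
  (* Coassociativity merges the two coactions on [m] into a comultiplication of [a]; the condition
     for [N] at [β1^-1 a] then applies, and coassociativity splits [a] back. *)
  transitivity (\tsum_(a ⊗ x <- lcoact m) \tsum_(d ⊗ m0 <- lcoact x)
    \tsum_(y ⊗ b <- rcoact n) \tsum_(c ⊗ n0 <- lcoact (β1^-1%g a ▷ y))
    ((α2 * β1 * α2^-1)%g
       (c * β2 (β1^-1%g d))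
     ⊗ (n0 ⊗ m0 ◁ δ1^-1%g b))).
    tm; by rewrite !autE.
  rewrite -(tsum_lcoassoc (F := fun a d m0 => \tsum_(y ⊗ b <- rcoact n)
    \tsum_(c ⊗ n0 <- lcoact (β1^-1%g a ▷ y))
    ((α2 * β1 * α2^-1)%g
       (c * β2 (β1^-1%g d))
     ⊗ (n0 ⊗ m0 ◁ δ1^-1%g b)))); last lin.
  transitivity (\tsum_(a ⊗ m0 <- lcoact m) \tsum_(y ⊗ b <- rcoact n)
    \tsum_(p ⊗ q <- hdelta (β1^-1%g a)) \tsum_(c ⊗ n0 <- lcoact (p ▷ y))
    ((α2 * β1 * α2^-1)%g (c * β2 q)
     ⊗ (n0 ⊗ m0 ◁ δ1^-1%g b))).
    nfr; by tm.
  under_sums 2 (symmetry; refine (tsum_LR_left (F := fun A B =>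
     ((α2 * β1 * α2^-1)%g A ⊗ (B ⊗ _))) _ _ _); lin).
  transitivity (\tsum_(a ⊗ m0 <- lcoact m) \tsum_(p ⊗ q <- hdelta a)
    \tsum_(y ⊗ b <- rcoact n) \tsum_(c ⊗ n0 <- lcoact y)
    (α2 p * (α2 * β1 * α2^-1)%g c
     ⊗ (β1^-1%g q ▷ n0 ⊗ m0 ◁ δ1^-1%g b))).
    nfl; tm; by rewrite !autE.
  rewrite tsum_lcoassoc; last lin.
  under_sums 2 (symmetry; refine (tsum_lrcoact (F := fun c n0 b =>
    (α2 _ * (α2 * β1 * α2^-1)%g c
     ⊗ (β1^-1%g _ ▷ n0 ⊗ _ ◁ δ1^-1%g b))) _ _); lin).
  tm; by rewrite !autE.
- move=> x; by_pure x => m n; nfl; nfr.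
  (* The mirror image: the two right coactions on [n] merge, and the condition for [M] applies at
     [δ1^-1 y]. *)
  under_sums 1 (symmetry; refine (tsum_rcoassoc (F := fun n0 c b =>
    \tsum_(m0 ⊗ d <- rcoact (_ ◁ δ1^-1%g b))
    ((β1^-1%g _ ▷ n0 ⊗ m0) ⊗
     ((γ1 * δ1^-1)%g c * d))) _ _); lin).
  transitivity (\tsum_(a ⊗ x <- lcoact m) \tsum_(n0 ⊗ y <- rcoact n)
    \tsum_(c ⊗ b <- hdelta (δ1^-1%g y)) \tsum_(m0 ⊗ d <- rcoact (x ◁ b))
    ((β1^-1%g a ▷ n0 ⊗ m0) ⊗ (γ1 c * d))).
    nfr; by tm.
  under_sums 2 (symmetry;
    refine (tsum_LR_right (F := fun A B => ((_ ⊗ A) ⊗ B)) _ _ _); lin).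
  transitivity (\tsum_(a ⊗ x <- lcoact m) \tsum_(m0 ⊗ d <- rcoact x)
    \tsum_(n0 ⊗ y <- rcoact n) \tsum_(c ⊗ b <- hdelta y)
    ((β1^-1%g a ▷ n0 ⊗ m0 ◁ δ1^-1%g c) ⊗ (d * b))).
    nfl; tm; by rewrite !autE.
  rewrite tsum_lrcoact; last lin.
  under_sums 2 (refine (tsum_rcoassoc _ _); lin).
  by tm.
Qed.
End Braid.

(** * The inverse of the braiding *)

Section Antipode.
Variables (k : fieldType) (H : hopfAlgType k).

Lemma antipode1 : antipode (1 : H) = 1.
Proof.
have := tsum_antipodel (F := fun y : H => y) 1 (@lin_id k H).
by rewrite delta1 tsum_tens ?mulr1 ?eps_one ?scale1r //; lin.
Qed.

(* Both sides equal S(g1 h1) g2 h2 S(h3) S(g3) *)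
Lemma antipodeM (g h : H) : antipode (g * h) = antipode h * antipode g.
Proof.
pose F g1 g2 g3 := \tsum_(h1 ⊗ y <- hdelta h) \tsum_(h2 ⊗ h3 <- hdelta y)
  (antipode (g1 * h1) * (g2 * h2) * (antipode h3 * antipode g3)).
transitivity (\tsum_(g1 ⊗ x <- hdelta g) \tsum_(g2 ⊗ g3 <- hdelta x) F g1 g2 g3).
  symmetry; rewrite /F.
  (* Here [h2 * antipode h3] and then [g2 * antipode g3] collapse, leaving [antipode (g * h)]. *)
  transitivity (\tsum_(g1 ⊗ x <- hdelta g) \tsum_(g2 ⊗ g3 <- hdelta x)
      (antipode (g1 * h) * (g2 * antipode g3))).
    apply: eq_tsum_ptwise => u v; apply: eq_tsum_ptwise => u0 v0.
    transitivity (\tsum_(h1 ⊗ y <- hdelta h) \tsum_(h2 ⊗ h3 <- hdelta y)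
      (antipode (u * h1) * (u0 * (h2 * antipode h3) * antipode v0))).
      by tm; rewrite !mulrA.
    under_sums 1 (refine (tsum_antipoder
      (F := fun y => antipode (u * _) * (u0 * y * antipode v0)) _ _); lin).
    by rewrite tsum_counitr ?mulr1; last lin.
  under_sums 1 (refine (tsum_antipoder (F := fun y => antipode (_ * h) * y) _ _); lin).
  rewrite tsum_counitr ?mulr1 //; lin.
(* Regrouped, [antipode (g1 * h1) * (g2 * h2)] collapses by the left antipode law at a product. *)
rewrite -tsum_coassoc /F; last lin.
transitivity (\tsum_(x ⊗ g3 <- hdelta g) \tsum_(y ⊗ h3 <- hdelta h)
  \tsum_(a ⊗ b <- hdelta (x * y)) (antipode a * b * (antipode h3 * antipode g3))).
  etransitivity; [|symmetry; nf].
  under_sums 2 (rewrite -tsum_coassoc; [reflexivity | lin]).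
  by tm.
under_sums 1 (under_sums 1 (
    rewrite (tsum_antipodel (F := fun z => z * (antipode _ * antipode _))); last lin;
    rewrite eps_mul mul1r mulrC -scalerA; reflexivity);
  refine (tsum_counitl _ _); lin).
by rewrite (tsum_counitl (F := fun y => antipode h * antipode y)); last lin.
Qed.

Variable S' : H -> H.
Hypotheses (SK : cancel antipode S') (S'K : cancel S' antipode).

Lemma lin_antipodeV : islin S'.
Proof. by move=> a x y; apply: (can_inj SK); rewrite (@antipode_linear k H) !S'K. Qed.

(** Since the antipode reverses products, [S' h2 * h1] is [S'] of [antipode h1 * h2]. *)
Lemma tsum_antipodeVl (W : lmodType k) (F : H -> W) h : islin F ->
  \tsum_(h1 ⊗ h2 <- hdelta h) F (S' h2 * h1) = heps h *: F 1.
Proof.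
move=> Fl; have Sl := lin_antipodeV.
transitivity (\tsum_(h1 ⊗ h2 <- hdelta h) F (S' (antipode h1 * h2))).
  by tm; rewrite -[S' v * u]SK antipodeM S'K.
rewrite (tsum_antipodel (F := fun y => F (S' y))); last lin.
by rewrite -[in LHS]antipode1 SK.
Qed.

Lemma tsum_antipodeVr (W : lmodType k) (F : H -> W) h : islin F ->
  \tsum_(h1 ⊗ h2 <- hdelta h) F (h2 * S' h1) = heps h *: F 1.
Proof.
move=> Fl; have Sl := lin_antipodeV.
transitivity (\tsum_(h1 ⊗ h2 <- hdelta h) F (S' (h1 * antipode h2))).
  by tm; rewrite -[v * S' u]SK antipodeM S'K.
rewrite (tsum_antipoder (F := fun y => F (S' y))); last lin.
by rewrite -[in LHS]antipode1 SK.
Qed.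
End Antipode.

(** * Bijectivity of the braiding *)

Section BraidInverse.
Variables (k : fieldType) (H1 H2 : hopfAlgType k) (M N : LRobj H1 H2).
Local Notation β1 := (lrβ (LRdeg M)).
Local Notation δ1 := (lrδ (LRdeg M)).
Variables (S1 : H1 -> H1) (S2 : H2 -> H2).
Hypotheses (S1K : cancel antipode S1) (KS1 : cancel S1 antipode).
Hypotheses (S2K : cancel antipode S2) (KS2 : cancel S2 antipode).

(** Conjugating [N] does not change its space, so a map out of [tensor N M] is a map out of the
    target of the braiding. *)
Definition LRbraidV (y : tensor N M) : tensor M N :=
  \tsum_(n ⊗ m <- y) \tsum_(a ⊗ m0 <- lcoact m) \tsum_(n0 ⊗ b <- rcoact n)
    (m0 ◁ (δ1^-1%g (S2 b)) ⊗ (β1^-1%g (S1 a)) ▷ n0).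

(** Coassociativity merges the repeated coactions, the laws of the inverse antipodes cancel the
    factors acting on [n] and on [m], and the counit laws remove what is left. *)
Lemma LRbraidK (x : tensor M N) : LRbraidV (@LRbraid k H1 H2 M N x) = x.
Proof.
have S1l := lin_antipodeV S1K KS1; have S2l := lin_antipodeV S2K KS2.
rewrite /LRbraidV /LRbraid; by_pure x => m n; nfl.
transitivity (\tsum_(a ⊗ x <- lcoact m) \tsum_(b ⊗ m0 <- lcoact x)
  \tsum_(y ⊗ d <- rcoact n) \tsum_(n0 ⊗ c <- rcoact y)
  (m0 ◁ (δ1^-1%g (d * S2 c)) ⊗ (β1^-1%g (S1 b * a)) ▷ n0)).
  tm; by rewrite !autE actMl actMr.
rewrite -(tsum_lcoassoc (F := fun a b m0 =>
  \tsum_(y ⊗ d <- rcoact n) \tsum_(n0 ⊗ c <- rcoact y)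
  (m0 ◁ (δ1^-1%g (d * S2 c)) ⊗ (β1^-1%g (S1 b * a)) ▷ n0))); last lin.
under_sums 1 (refine (tsum_antipodeVl S1K KS1 (F := fun z =>
  \tsum_(y ⊗ d <- rcoact n) \tsum_(n0 ⊗ c <- rcoact y)
  (_ ◁ (δ1^-1%g (d * S2 c)) ⊗ β1^-1%g z ▷ n0)) _ _); lin).
rewrite tsum_lcounit; last lin.
rewrite -(tsum_rcoassoc (F := fun n0 c d =>
  (m ◁ (δ1^-1%g (d * S2 c)) ⊗ β1^-1%g 1 ▷ n0))); last lin.
under_sums 1 (refine (tsum_antipodeVr S2K KS2 (F := fun z =>
  (_ ◁ δ1^-1%g z ⊗ β1^-1%g 1 ▷ _)) _ _); lin).
by rewrite tsum_rcounit ?autE ?act1l ?act1r; last lin.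
Qed.

Lemma LRbraidVK (y : tensor N M) : @LRbraid k H1 H2 M N (LRbraidV y) = y.
Proof.
have S1l := lin_antipodeV S1K KS1; have S2l := lin_antipodeV S2K KS2.
rewrite /LRbraidV /LRbraid; by_pure y => n m; nfl.
transitivity (\tsum_(a ⊗ x <- lcoact m) \tsum_(b ⊗ m0 <- lcoact x)
  \tsum_(y ⊗ d <- rcoact n) \tsum_(n0 ⊗ c <- rcoact y)
  ((β1^-1%g (b * S1 a)) ▷ n0 ⊗ m0 ◁ (δ1^-1%g (S2 d * c)))).
  tm; by rewrite !autE actMl actMr.
rewrite -(tsum_lcoassoc (F := fun a b m0 =>
  \tsum_(y ⊗ d <- rcoact n) \tsum_(n0 ⊗ c <- rcoact y)
  ((β1^-1%g (b * S1 a)) ▷ n0 ⊗ m0 ◁ (δ1^-1%g (S2 d * c))))); last lin.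
under_sums 1 (refine (tsum_antipodeVr S1K KS1 (F := fun z =>
  \tsum_(y ⊗ d <- rcoact n) \tsum_(n0 ⊗ c <- rcoact y)
  (β1^-1%g z ▷ n0 ⊗ _ ◁ (δ1^-1%g (S2 d * c)))) _ _); lin).
rewrite tsum_lcounit; last lin.
rewrite -(tsum_rcoassoc (F := fun n0 c d =>
  (β1^-1%g 1 ▷ n0 ⊗ m ◁ (δ1^-1%g (S2 d * c))))); last lin.
under_sums 1 (refine (tsum_antipodeVl S2K KS2 (F := fun z =>
  (β1^-1%g 1 ▷ _ ⊗ _ ◁ δ1^-1%g z)) _ _); lin).
by rewrite tsum_rcounit ?autE ?act1l ?act1r; last lin.
Qed.
End BraidInverse.

Section Closed.
Variables (k : fieldType) (H1 H2 : hopfAlgType k).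

Lemma LRhom_inv (M N : LRobj H1 H2) (f : LRhom M N) (g : N -> M) :
  cancel f g -> cancel g f -> is_LRhom g.
Proof.
move=> fK gK; have [fd fl fL fR fC fD] := LRhomP f.
have gl : islin g by move=> a x y; apply: (can_inj fK); rewrite fl !gK.
split=> //.
- by move=> h m; apply: (can_inj fK); rewrite fL !gK.
- by move=> m h; apply: (can_inj fK); rewrite fR !gK.
(* Only the [m] on the right is written as [f (g m)], so that colinearity of [f] exposes a sum over
   [lcoact (g m)]. *)
- move=> m; rewrite -{2}(gK m); nfr.
  rewrite -[LHS]tsum_id; tm; by rewrite fK.
- move=> m; rewrite -{2}(gK m); nfr.
  rewrite -[LHS]tsum_id; tm; by rewrite fK.
Qed.
End Closed.

(** * The T-category *)

Section Functors.
Local Notation hom := Defs.hom.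

(** Equal arrows have morphisms that agree up to transport along equalities of sources and targets;
    here both equalities are reflexivity. *)
Lemma Arrow_inj (C : category) (U V : C) (f g : Defs.hom U V) : Arrow f = Arrow g -> f = g.
Proof.
move=> e.
suff castE (a b : arrow C) (eq : a = b)
    (es : source a = source b) (et : target a = target b) :
    ecast c (hom (source b) c) et (ecast c (hom c (target a)) es (arr a)) = arr b.
  exact: (castE _ _ e erefl erefl).
case: b / eq in es et *.
by rewrite (Prop_irrelevance es erefl) (Prop_irrelevance et erefl).
Qed.

(** Morphisms are compared as arrows because their types depend on the object map; once the object
    maps are identified, [Arrow_inj] applies, and the laws agree by proof irrelevance. *)
Lemma functor_ext (C D : category) (F G : functor C D) :
  (forall U, F U = G U) ->
  (forall U V (f : Defs.hom U V), Arrow (fmap F f) = Arrow (fmap G f)) -> F = G.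
Proof.
case: F G => [F Fm F1 FM] [G Gm G1 GM] /= eo em.
have eFG : F = G by apply/funext.
case: _ / eFG in Gm G1 GM eo em *.
have eFm : Fm = Gm.
  apply/functional_extensionality_dep => U; apply/functional_extensionality_dep => V.
  by apply/funext => f; apply: Arrow_inj.
case: _ / eFm in G1 GM em *.
by rewrite (Prop_irrelevance F1 G1) (Prop_irrelevance FM GM).
Qed.
End Functors.

(** * Equality of objects and arrows over the same underlying spaces *)

Section Structures.
Variables (k : fieldType) (H1 H2 : hopfAlgType k).
Implicit Types M N P : LRobj H1 H2.

(* The index and the structure maps of an object, as a function of its underlying
   space, so that objects with convertible spaces can be compared without casts *)
Definition LRstruct (V : lmodType k) :=
  (LRgroup H1 H2 * (H1 -> V -> V) * (V -> H2 -> V) *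
   (V -> tensor H1 V) * (V -> tensor V H2))%type.

Definition LRof (V : lmodType k) (s : LRstruct V) : LRpre H1 H2 :=
  LRPre s.1.1.1.1 s.1.1.1.2 s.1.1.2 s.1.2 s.2.

Definition LRstr (P : LRpre H1 H2) : LRstruct P :=
  (LRdeg P, @lact _ _ _ P, @ract _ _ _ P, @lcoact _ _ _ P, @rcoact _ _ _ P).

Lemma LRobj_ext (V : lmodType k) (s s' : LRstruct V)
    (p : is_LR (LRof s)) (p' : is_LR (LRof s')) :
  s = s' -> LRObj p = LRObj p'.
Proof. by move=> e; case: s' / e in p' *; rewrite (Prop_irrelevance p p'). Qed.

(** The sources share the space [V] and the targets the space [W], so [f] and [f'] are compared as
    functions without transport, even when the structures are only provably equal. *)
Lemma Arrow_ext (V W : lmodType k) (s s' : LRstruct V) (t t' : LRstruct W)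
    (p : is_LR (LRof s)) (p' : is_LR (LRof s'))
    (q : is_LR (LRof t)) (q' : is_LR (LRof t'))
    (f : LRhom (LRObj p) (LRObj q)) (f' : LRhom (LRObj p') (LRObj q')) :
  s = s' -> t = t' -> (forall x : V, f x = f' x) ->
  @Arrow (LRcat H1 H2) _ _ f = @Arrow (LRcat H1 H2) _ _ f'.
Proof.
move=> es et; case: s' / es in p' f' *; case: t' / et in q' f' *.
case: _ / (Prop_irrelevance p p') in f' *; case: _ / (Prop_irrelevance q q') in f' *.
by move=> ff; congr Arrow; apply: LRhom_ext.
Qed.

Lemma LRstr_eq (V : lmodType k) (s s' : LRstruct V) :
  s.1.1.1.1 = s'.1.1.1.1 -> (forall h m, s.1.1.1.2 h m = s'.1.1.1.2 h m) ->
  (forall m h, s.1.1.2 m h = s'.1.1.2 m h) -> (forall m, s.1.2 m = s'.1.2 m) ->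
  (forall m, s.2 m = s'.2 m) -> s = s'.
Proof.
case: s s' => [[[[d l] r] c] e] [[[[d' l'] r'] c'] e'] /= -> hl hr hc he.
congr (_, _, _, _, _); do 2 ?[by apply/funext | apply/funext => ?]; exact/funext.
Qed.

Lemma LRstr_conj1 N : LRstr (LRconj 1%g N) = LRstr N.
Proof.
apply: LRstr_eq; rewrite /LRstr; cbn [fst snd]; unf.
- by rewrite mul1g invg1 mulg1.
- by move=> h n; rewrite !degE !autE.
- by move=> n h; rewrite !degE !autE.
- by move=> n; rewrite -[RHS]tsum_id; tm; rewrite !degE !autE.
- by move=> n; rewrite -[RHS]tsum_id; tm; rewrite !degE !autE.
Qed.

Lemma LRstr_conjM a b N : LRstr (LRconj (a * b)%g N) = LRstr (LRconj a (LRconj b N)).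
Proof.
apply: LRstr_eq; rewrite /LRstr; cbn [fst snd]; unf.
- by rewrite invgM !mulgA.
- by move=> h n; rewrite !degE !autE.
- by move=> n h; rewrite !degE !autE.
- by move=> n; nfr; tm; rewrite !degE !autE.
- by move=> n; nfr; tm; rewrite !degE !autE.
Qed.

Lemma LRstr_conj_unit a : LRstr (LRconj a (LRunit H1 H2)) = LRstr (LRunit H1 H2).
Proof.
apply: LRstr_eq; rewrite /LRstr; cbn [fst snd]; unf.
- by rewrite mulg1 mulgV.
- by move=> h n; rewrite !aut_eps.
- by move=> n h; rewrite !aut_eps.
- by move=> n; nfl; rewrite !aut_one.
- by move=> n; nfl; rewrite !aut_one.
Qed.

Lemma LRstr_conj_tens a M N :
  LRstr (LRconj a (LRtens M N)) = LRstr (LRtens (LRconj a M) (LRconj a N)).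
Proof.
apply: LRstr_eq; rewrite /LRstr; cbn [fst snd]; unf.
- by rewrite !mulgA mulgVK.
- by move=> h x; by_pure x => m n; nfl; nfr; tm; rewrite ?autE.
- by move=> x h; by_pure x => m n; nfl; nfr; tm; rewrite !degE !autE.
- by move=> x; by_pure x => m n; nfl; nfr; tm; rewrite !degE !autE.
- by move=> x; by_pure x => m n; nfl; nfr; tm; rewrite !autE.
Qed.
End Structures.

(** * Coherence of the tensor product of vector spaces *)

Section TensorCoherence.
Variable k : fieldType.
Implicit Types U V W X : lmodType k.

(** The unit constraints on bare spaces, convertible to [LRlunit] and [LRrunit], so that coherence
    is proved for vector spaces alone. *)
Definition tlunit U (x : tensor k^o U) : U := tsum (fun (a : k^o) u => (a : k) *: u) x.
Definition trunit U (x : tensor U k^o) : U := tsum (fun u (a : k^o) => (a : k) *: u) x.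

Lemma tassoc_nat U V W U' V' W' (f : U -> U') (g : V -> V') (h : W -> W') x :
  islin f -> islin g -> islin h ->
  tmap f (tmap g h) (tassoc x) = tassoc (tmap (tmap f g) h x).
Proof.
move=> fl gl hl; rewrite /tassoc /tmap; by_pure x => y w; by_pure y => u v.
by nfl; nfr.
Qed.

Lemma tassocK U V W : cancel (@tassoc k U V W) (@tassocV k U V W).
Proof.
by rewrite /tassoc /tassocV => x; by_pure x => y w; by_pure y => u v; nfl.
Qed.

Lemma tassocVK U V W : cancel (@tassocV k U V W) (@tassoc k U V W).
Proof.
by rewrite /tassoc /tassocV => x; by_pure x => u y; by_pure y => v w; nfl.
Qed.

Lemma tpentagon U V W X (x : tensor (tensor (tensor U V) W) X) :
  tassoc (tassoc x) =
  tmap id (@tassoc k V W X) (tassoc (tmap (@tassoc k U V W) id x)).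
Proof.
rewrite /tassoc /tmap; by_pure x => y a; by_pure y => z w; by_pure z => u v.
by nfl; nfr.
Qed.

Lemma ttriangle U V (x : tensor (tensor U k^o) V) :
  tmap id (@tlunit V) (tassoc x) = tmap (@trunit U) id x.
Proof.
rewrite /tassoc /tmap /tlunit /trunit; by_pure x => y v; by_pure y => u a.
by nfl; nfr; rewrite islinZ ?(islinZ (F := fun y => y ⊗ v)) //; lin.
Qed.

Lemma tlunit_nat U V (f : U -> V) x : islin f -> f (tlunit x) = tlunit (tmap id f x).
Proof.
move=> fl; rewrite /tlunit /tmap; by_pure x => a u.
by nfl; nfr; rewrite islinZ.
Qed.

Lemma trunit_nat U V (f : U -> V) x : islin f -> f (trunit x) = trunit (tmap f id x).
Proof.
move=> fl; rewrite /trunit /tmap; by_pure x => u a.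
by nfl; nfr; rewrite islinZ.
Qed.

Lemma tlunitK U : cancel (@tlunit U) (fun u => (1 : k^o) ⊗ u).
Proof.
rewrite /tlunit => x; by_pure x => a u; nfl.
by rewrite islinZ -?(islinZ (F := fun y => y ⊗ u)) ?[_ *: _]mulr1 //; lin.
Qed.

Lemma tlunitVK U : cancel (fun u => (1 : k^o) ⊗ u) (@tlunit U).
Proof. by rewrite /tlunit => u; nfl; rewrite scale1r. Qed.

Lemma trunitK U : cancel (@trunit U) (fun u => u ⊗ (1 : k^o)).
Proof.
rewrite /trunit => x; by_pure x => u a; nfl.
rewrite (islinZ (F := fun y => y ⊗ _)) -?(islinZ (F := fun y => u ⊗ y)) ?[_ *: _]mulr1 //.
all: lin.
Qed.

Lemma trunitVK U : cancel (fun u => u ⊗ (1 : k^o)) (@trunit U).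
Proof. by rewrite /trunit => u; nfl; rewrite scale1r. Qed.

End TensorCoherence.

Section Closed.
Variables (k : fieldType) (H1 H2 : hopfAlgType k).

Lemma LR_is_closed : LR_closed H1 H2.
Proof.
split.
- exact: LRunitP.
- exact: LRtensP.
- exact: LRconjP.
- exact: LRtensmP.
- exact: LRconjmP.
- exact: LRassocP.
- exact: LRassocVP.
- exact: LRlunitP.
- exact: LRrunitP.
- exact: LRbraidP.
Qed.

Variable cl : LR_closed H1 H2.

Lemma LR_iso (M N : LRobj H1 H2) (f : LRhom M N) (g : N -> M) :
  cancel f g -> cancel g f -> @is_iso (LRcat H1 H2) M N f.
Proof.
move=> fK gK; exists (LRHom (LRhom_inv fK gK)).
by split; apply: LRhom_ext.
Qed.

Lemma LR_monoidal : is_monoidal (LRdata cl).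
Proof.
split.
- move=> U U' V V' W W' f g h; apply: LRhom_ext => x /=.
  by apply: tassoc_nat; exact: LRhom_linear (LRhomP _).
- by move=> U V W; apply: LRhom_ext => x; exact: tassocK.
- by move=> U V W; apply: LRhom_ext => x; exact: tassocVK.
- by move=> U V f; apply: LRhom_ext => x; exact/tlunit_nat/(LRhom_linear (LRhomP _)).
- move=> U; apply: (@LR_iso (LRObj (cl_tens cl (LRObj (cl_unit cl)) U)) U _
    (fun m => (1 : k^o) ⊗ m)) => [x | m]; [exact: tlunitK | exact: tlunitVK].
- by move=> U V f; apply: LRhom_ext => x; exact/trunit_nat/(LRhom_linear (LRhomP _)).
- move=> U; apply: (@LR_iso (LRObj (cl_tens cl U (LRObj (cl_unit cl)))) U _
    (fun m => m ⊗ (1 : k^o))) => [x | m]; [exact: trunitK | exact: trunitVK].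
- by move=> U V W X; apply: LRhom_ext => x; exact: tpentagon.
- by move=> U V; apply: LRhom_ext => x; exact: ttriangle.
Qed.
End Closed.

(** * The braiding axioms on underlying spaces *)

Section BraidEquations.
Variables (k : fieldType) (H1 H2 : hopfAlgType k).
Implicit Types U V W M N : LRobj H1 H2.

Lemma LRbraid_nat U U' V V' (f : LRhom U U') (g : LRhom V V') (x : tensor U V) :
  tmap g f (@LRbraid _ _ _ U V x) = @LRbraid _ _ _ U' V' (tmap f g x) :> tensor V' U'.
Proof.
rewrite /LRbraid /tmap -(LRhom_deg (LRhomP f)); unf; by_pure x => u v; nfl; nfr; tm.
by rewrite (LRhom_lact (LRhomP g)) (LRhom_ract (LRhomP f)).
Qed.

Lemma LRbraid_tensl U V W (x : tensor (tensor U V) W) :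
  @LRbraid _ _ _ (LRtens U V) W x =
  tassoc (tmap (@LRbraid _ _ _ U (LRconj (LRdeg V) W) : tensor U W -> tensor W U) id
    (tassocV (tmap id (@LRbraid _ _ _ V W : tensor V W -> tensor W V) (tassoc x))))
  :> tensor W (tensor U V).
Proof.
rewrite /LRbraid /tmap /tassoc /tassocV; unf; by_pure x => y w; by_pure y => u v.
nfl; nfr.
(* Acting on the product of [U] and [V] comultiplies the right leg of [w]; coassociativity turns
   this into the coactions of two successive braidings. *)
under_sums 2 (refine (tsum_rcoassoc _ _); lin).
tm; by rewrite !degE !autE actMl.
Qed.

Lemma LRbraid_tensr U V W (x : tensor U (tensor V W)) :
  @LRbraid _ _ _ U (LRtens V W) x =
  tassocV (tmap id (@LRbraid _ _ _ U W : tensor U W -> tensor W U)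
    (tassoc (tmap (@LRbraid _ _ _ U V : tensor U V -> tensor V U) id (tassocV x))))
  :> tensor (tensor V W) U.
Proof.
rewrite /LRbraid /tmap /tassoc /tassocV; unf; by_pure x => u y; by_pure y => v w.
nfl; nfr.
etransitivity; [refine (eq_tsum_ptwise _ _) => a u0; bring (hdelta a)|].
rewrite tsum_lcoassoc; last lin.
tm; by rewrite !autE actMr.
Qed.

Lemma LRbraid_conj a U V (x : tensor U V) :
  @LRbraid _ _ _ U V x = @LRbraid _ _ _ (LRconj a U) (LRconj a V) x :> tensor V U.
Proof.
rewrite /LRbraid; unf; by_pure x => u v.
nfl; nfr; tm; by rewrite !degE !autE.
Qed.
End BraidEquations.


(** * Strictness of conjugation, and the crossed and braided structures *)

Section TCategory.
Variables (k : fieldType) (H1 H2 : hopfAlgType k).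
Implicit Types U V W M N : LRobj H1 H2.

(** Congruence in one tensor factor, for comparing iterated tensor products step by step. *)
Lemma LRstr_tensl (V : lmodType k) (s s' : LRstruct H1 H2 V) (P : LRpre H1 H2) :
  s = s' -> LRstr (LRtens (LRof s) P) = LRstr (LRtens (LRof s') P).
Proof. by move=> ->. Qed.

Lemma LRstr_tensr (V : lmodType k) (s s' : LRstruct H1 H2 V) (P : LRpre H1 H2) :
  s = s' -> LRstr (LRtens P (LRof s)) = LRstr (LRtens P (LRof s')).
Proof. by move=> ->. Qed.

Variable cl : LR_closed H1 H2.
Local Notation C := (LRdata cl).

Lemma LRconj_functor1 : t_conj C 1%g = id_functor C.
Proof.
(* A variable object is destructed so that it has the form [LRObj] over [LRof]; conjugates and
   tensor products have it by computation. *)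
apply: functor_ext => [[[V d l r c e] p] | [[V d l r c e] p] [[V' d' l' r' c' e'] p'] f].
- exact: (LRobj_ext _ _ (LRstr_conj1 (LRObj p))).
- exact: (Arrow_ext (LRstr_conj1 (LRObj p)) (LRstr_conj1 (LRObj p'))).
Qed.

Lemma LRconj_functorM a b :
  t_conj C (a * b)%g = comp_functor (t_conj C a) (t_conj C b).
Proof.
apply: functor_ext => [N | N N' f].
- exact: (LRobj_ext _ _ (LRstr_conjM a b N)).
- exact: (Arrow_ext (LRstr_conjM a b N) (LRstr_conjM a b N')).
Qed.

Lemma LR_strict a : strict_tensor_functor (t_conj C a).
Proof.
split.
- apply: functor_ext => [[M N] | [M N] [M' N'] [f g]].
  + exact: (LRobj_ext _ _ (LRstr_conj_tens a M N)).
  + exact: (Arrow_ext (LRstr_conj_tens a M N) (LRstr_conj_tens a M' N')).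
- exact: (LRobj_ext _ _ (LRstr_conj_unit a)).
- move=> U V W.
  pose UV := LRObj (cl_tens cl U V); pose VW := LRObj (cl_tens cl V W).
  (* The maps coincide as functions; for the structures, conjugation is distributed over the outer
     tensor product and then over the inner one. *)
  apply: (Arrow_ext
    (etrans (LRstr_conj_tens a UV W) (LRstr_tensl (LRconj a W) (LRstr_conj_tens a U V)))
    (etrans (LRstr_conj_tens a U VW) (LRstr_tensr (LRconj a U) (LRstr_conj_tens a V W)))).
  by [].
- move=> U; pose I := LRObj (cl_unit cl).
  apply: (Arrow_ext
    (etrans (LRstr_conj_tens a I U) (LRstr_tensl (LRconj a U) (LRstr_conj_unit a)))
    (erefl (LRstr (LRconj a U)))).
  by [].
- move=> U; pose I := LRObj (cl_unit cl).
  apply: (Arrow_ext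
    (etrans (LRstr_conj_tens a U I) (LRstr_tensr (LRconj a U) (LRstr_conj_unit a)))
    (erefl (LRstr (LRconj a U)))).
  by [].
Qed.

Lemma LR_crossed : is_crossed C.
Proof.
split.
- by move=> U V f; exact: LRhom_deg (LRhomP f).
- by [].
- exact: LR_strict.
- exact: LRconj_functor1.
- exact: LRconj_functorM.
- move=> b a V; split=> [[U <- <-] // | degV].
  (* Conjugation is a homomorphism, so the preimage of [V] is its conjugate by [b^-1]. *)
  exists (t_conj C b^-1%g V).
    by rewrite /= [LRdeg _]degV invgK !mulgA mulVg mul1g mulgVK.
  have := congr1 (fun F : functor C C => F V) (LRconj_functorM b b^-1%g).
  by rewrite mulgV LRconj_functor1.
Qed.
(** The inverses of the antipodes provide the inverse of the braiding. The other axioms combine an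
    equality of functions with equalities of the structures on source and target. *)
Lemma LR_braided :
  bijective (@antipode k H1) -> bijective (@antipode k H2) -> is_braided C.
Proof.
case=> S1 S1K KS1 [S2 S2K KS2]; split.
- move=> U V.
  apply: (@LR_iso k H1 H2 _ _ (t_braid (U : C) (V : C)) (@LRbraidV k H1 H2 U V S1 S2)).
  - exact: (LRbraidK S1K KS1 S2K KS2).
  - exact: (@LRbraidVK k H1 H2 U V _ _ S1K KS1 S2K KS2).
- move=> U U' V V' f g.
  (* The existence of [f] forces [U] and [U'] to have equal indices. *)
  have e : LRstr (LRconj (LRdeg U) V') = LRstr (LRconj (LRdeg U') V').
    by rewrite (LRhom_deg (LRhomP f)).
  apply: (Arrow_ext (erefl (LRstr (LRtens U V))) (LRstr_tensl U' e)) => x.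
  exact: (@LRbraid_nat k H1 H2 U U' V V' f g x).
- move=> U V W; pose UV := LRObj (cl_tens cl U V).
  apply: (Arrow_ext (erefl (LRstr (LRtens UV W)))
    (LRstr_tensl UV (LRstr_conjM (LRdeg U) (LRdeg V) W))) => x.
  exact: (@LRbraid_tensl k H1 H2 U V W x).
- move=> U V W; pose VW := LRObj (cl_tens cl V W).
  apply: (Arrow_ext (erefl (LRstr (LRtens U VW)))
    (LRstr_tensl U (LRstr_conj_tens (LRdeg U) V W))) => x.
  exact: (@LRbraid_tensr k H1 H2 U V W x).
- move=> a U V; pose cV := LRObj (cl_conj cl (LRdeg U) V).
  (* Conjugating by [LRdeg U] and then by [a] is conjugating by [a] and then by the index of the
     conjugate of [U]. *)
  have e : LRstr (LRconj a (LRconj (LRdeg U) V))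
         = LRstr (LRconj (a * LRdeg U * a^-1)%g (LRconj a V)).
    by rewrite -!LRstr_conjM mulgVK.
  apply: (Arrow_ext (LRstr_conj_tens a U V)
    (etrans (LRstr_conj_tens a cV U) (LRstr_tensl (LRconj a U) e))) => x.
  exact: (@LRbraid_conj k H1 H2 a U V x).
Qed.
End TCategory.

Theorem theorem2p8 (k : fieldType) (H1 H2 : hopfAlgType k)
    (antipode1_bij : bijective (@antipode k H1))
    (antipode2_bij : bijective (@antipode k H2)) :
  exists cl : LR_closed H1 H2, braided_T_category (LRdata cl).
Proof.
exists (LR_is_closed H1 H2); split.
- exact: LR_monoidal.
- exact: LR_crossed.
- exact: LR_braided.
Qed.
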